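(* Let $\alpha\ge 0$, $\beta\ge 0$, $\lambda\ge 0$, $\mu\ge 0$ be real numbers with $\lambda+\mu\ge 1$, and let $\{a_k\}_{k=1}^{\infty}$ be a sequence of positive real numbers with $a_1=1$ such that $$(2+\alpha)^{\lambda}(2+\beta)^{\mu}\,2a_2\le 1$$ and, for all integers $k\ge 2$, $$(k+1+\alpha)^{\lambda}(k+1+\beta)^{\mu}(k+1)a_{k+1}\le(k+\alpha)^{\lambda}(k+\beta)^{\mu}\,k\,a_k .$$ Then for every $n\in\mathbb{N}$ the polynomial $f_n(z)=z+\sum_{k=2}^{n}a_kz^k$, and also the function $f(z)=z+\sum_{k=2}^{\infty}a_kz^k$, are close-to-convex in $\mathbb{D}$ with respect to the starlike function $z/(1-z^2)$.
   Context: $\mathbb{D}=\{z\in\mathbb{C}:|z|<1\}$. $\mathcal{A}_0$ is the class of analytic functions $f$ on $\mathbb{D}$ with $f(0)=0$ and $f'(0)=1$. A function $g\in\mathcal{A}_0$ is starlike if $\mathrm{Re}\left(\frac{zg'(z)}{g(z)}\right)>0$ for all $z\in\mathbb{D}$. A function $f\in\mathcal{A}_0$ is close-to-convex with respect to a fixed starlike function $g$ if there is a real $\eta\in(-\pi/2,\pi/2)$ such that $\mathrm{Re}\left(e^{i\eta}\frac{zf'(z)}{g(z)}\right)>0$ for all $z\in\mathbb{D}$ (the quotient takes the value $1$ at $z=0$). An empty sum is zero. *)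

(* Defs.v *)
From Stdlib Require Import Reals.
From Coquelicot Require Import Coquelicot.
Open Scope R_scope.

Definition unit_disk (z : C) : Prop := Cmod z < 1.

(* [ex_derive] over [C_AbsRing] is complex differentiability; the structures
   are explicit because [C] is also a normed module over [R]. *)
Definition analytic_on_disk (f : C -> C) : Prop :=
  forall z : C, unit_disk z -> @ex_derive C_AbsRing C_NormedModule f z.

Definition class_A0 (f : C -> C) : Prop :=
  analytic_on_disk f /\ f 0%C = 0%C /\ C_derive f 0%C = 1%C.

(* z f'(z) / g(z), with its removable singularity at 0 filled in: for f and g
   in [class_A0] the limit at 0 is f'(0) / g'(0) = 1. *)
Definition zf'_over_g (f g : C -> C) (z : C) : C :=
  if Ceq_dec z 0%C then 1%C else (z * C_derive f z / g z)%C.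

(* Coquelicot's [Cdiv] is total with x / 0 = 0, so the strict inequality below,
   and the one in [close_to_convex], forces g(z) <> 0 for z <> 0 in the disk. *)
Definition starlike (g : C -> C) : Prop :=
  class_A0 g /\
  forall z : C, unit_disk z -> 0 < Re (zf'_over_g g g z).

Definition cis (t : R) : C := (cos t, sin t).

Definition close_to_convex (f g : C -> C) : Prop :=
  class_A0 f /\ starlike g /\
  exists eta : R, - (PI / 2) < eta < PI / 2 /\
    forall z : C, unit_disk z -> 0 < Re (cis eta * zf'_over_g f g z)%C.

Definition partial_poly (a : nat -> R) (n : nat) (z : C) : C :=
  (z + sum_n_m (fun k : nat => RtoC (a k) * Cpow z k) 2 n)%C.

Definition is_power_series_sum (a : nat -> R) (f : C -> C) : Prop :=
  forall z : C, unit_disk z ->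
    exists s : C,
      @is_series C_AbsRing C_NormedModule
        (fun k : nat => RtoC (a (k + 2)%nat) * Cpow z (k + 2))%C s /\
      f z = (z + s)%C.

(* Main.v *)
Require Import Defs.
From Stdlib Require Import Reals Lra Lia Psatz.
From Coquelicot Require Import Coquelicot.
Open Scope R_scope.

(** Put b_k = k a_k and g(z) = z / (1 - z^2).  Then z f'(z) / g(z) = (1 - z^2) f'(z),
    and for a polynomial its real part at z = e^(it) is 2 sin t (b_1 sin t + ... +
    b_n sin(nt)).  The claim holds with eta = 0 once these sine sums are shown to be
    nonnegative for 0 <= t <= pi and the sign is carried into the disk.

    The sine sums ([sine_sum_nonneg]).  Dividing lambda and mu by lambda + mu >= 1
    preserves the hypotheses, so the weight W_k may be taken to be a weighted
    geometric mean of k + alpha and k + beta.  Then k / W_k is at most 1 and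
    nondecreasing, while W_k b_k is nonincreasing and at most 1 from k = 2 on.  Two
    things follow: b_k decreases with b_2 <= 1/2, and k b_k = (k / W_k)(W_k b_k) has
    upward increments no larger than those of k / W_k, so that the sequence
    0, 2 b_2, ..., n b_n, 0 has total variation at most 2.  For t away from pi
    summation by parts against the decreasing b_k suffices
    ([sine_tail_ge_decreasing]).  Near pi the inequality is nearly sharp: when
    b_k = 1/k and n is even, the sum divided by pi - t tends to 0 as t tends to pi.
    There, with t = pi - 2x, sin(kt)/k is a difference of consecutive terms
    (-1)^m A_m(x), where A_m(x) is the integral of cos((2m+1)s) / cos s from 0 to x;
    since |A_m(x)| <= 1/2 sin(2x) for m >= 1 ([cos_quot_int_bound]), summation by
    parts against the variation of k b_k bounds the terms with k >= 2 below by
    -sin(2x) = -sin t ([sine_tail_ge_variation]).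

    The disk ([cos_poly_polar_ge]).  The real part of (1 - z^2) f_n'(z) is the Poisson
    integral of its boundary values, which are nonnegative and of mean 1, so it is at
    least (1 - |z|) / (1 + |z|).  This bound is independent of n and therefore passes
    to the power series, whose termwise derivative is justified by k^2 a_k <= 1
    ([is_C_derive_power_series]). *)

(** * Integrals of cos((2m+1)s) / cos s *)

Lemma nonneg_of_deriv_nonneg (F F' : R -> R) (x : R) :
  0 <= x -> F 0 = 0 ->
  (forall s, 0 <= s <= x -> is_derive F s (F' s)) ->
  (forall s, 0 <= s <= x -> 0 <= F' s) ->
  0 <= F x.
Proof.
intros Hx F0 HF Hpos.
destruct (MVT_gen F 0 x F') as [c [Hc Ec]].
- intros s Hs. rewrite Rmin_left, Rmax_right in Hs by lra. apply HF; lra.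
- intros s Hs. rewrite Rmin_left, Rmax_right in Hs by lra.
  apply continuity_pt_filterlim, (ex_derive_continuous F).
  exists (F' s). apply HF; lra.
- rewrite Rmin_left, Rmax_right in Hc by lra.
  rewrite F0, !Rminus_0_r in Ec. rewrite Ec.
  apply Rmult_le_pos; [apply Hpos|]; lra.
Qed.

(** The integral of cos((2m+1)s) / cos s from 0 to x.  The recursion comes from
    cos((2m+1)s) + cos((2m+3)s) = 2 cos s cos((2m+2)s); it matters below because
    it makes sin(2kx)/k the sum of two consecutive integrals. *)
Fixpoint cos_quot_int (m : nat) (x : R) : R :=
  match m with
  | O => x
  | S p => - cos_quot_int p x + sin (2 * INR (S p) * x) / INR (S p)
  end.

Lemma cos_quot_int_0 (m : nat) : cos_quot_int m 0 = 0.
Proof.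
induction m as [|m IH]; [reflexivity|].
cbn [cos_quot_int]. rewrite IH, Rmult_0_r, sin_0. unfold Rdiv; ring.
Qed.

Lemma cos_quot_int_derive (m : nat) (x : R) :
  cos x <> 0 ->
  is_derive (cos_quot_int m) x (cos ((2 * INR m + 1) * x) / cos x).
Proof.
intros Hc. induction m as [|m IH].
- replace (_ / _) with 1; [apply (is_derive_id (K:=R_AbsRing))|].
  simpl. rewrite Rmult_0_r, Rplus_0_l, Rmult_1_l. now field.
- cbn [cos_quot_int].
  assert (Hm : INR (S m) <> 0) by (apply not_0_INR; lia).
  replace (cos ((2 * INR (S m) + 1) * x) / cos x) with
    (- (cos ((2 * INR m + 1) * x) / cos x) + 2 * cos (2 * INR (S m) * x)).
  + apply (is_derive_plus (K:=R_AbsRing) (V:=R_NormedModule)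
             (fun x => - cos_quot_int m x)
             (fun x => sin (2 * INR (S m) * x) / INR (S m))).
    * now apply (is_derive_opp (K:=R_AbsRing) (V:=R_NormedModule)).
    * set (n := INR (S m)) in *. clearbody n. auto_derive; [trivial|]. now field.
  + rewrite S_INR.
    replace ((2 * (INR m + 1) + 1) * x) with (2 * (INR m + 1) * x + x) by ring.
    replace ((2 * INR m + 1) * x) with (2 * (INR m + 1) * x - x) by ring.
    rewrite cos_plus, cos_minus. now field.
Qed.

Lemma Rabs_sin_INR (n : nat) (s : R) : Rabs (sin (INR n * s)) <= INR n * Rabs (sin s).
Proof.
induction n as [|n IH].
- simpl. rewrite Rmult_0_l, sin_0, Rabs_R0. lra.
- rewrite S_INR, Rmult_plus_distr_r, Rmult_1_l, sin_plus.
  eapply Rle_trans; [apply Rabs_triang|]. rewrite !Rabs_mult.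
  assert (H1 := COS_bound s). assert (H2 := COS_bound (INR n * s)).
  assert (Rabs (cos s) <= 1) by (apply Rabs_le; lra).
  assert (Rabs (cos (INR n * s)) <= 1) by (apply Rabs_le; lra).
  assert (H3 := Rabs_pos (sin s)). assert (H4 := Rabs_pos (sin (INR n * s))).
  nra.
Qed.

Lemma cos_pos_of_small (x s : R) : 0 <= x -> x < PI / 2 -> 0 <= s <= x -> 0 < cos s.
Proof. intros. apply cos_gt_0; lra. Qed.


Lemma Rabs_le_of_deriv (F F' T T' : R -> R) (x : R) :
  0 <= x -> F 0 = 0 -> T 0 = 0 ->
  (forall s, 0 <= s <= x -> is_derive F s (F' s)) ->
  (forall s, 0 <= s <= x -> is_derive T s (T' s)) ->
  (forall s, 0 <= s <= x -> Rabs (F' s) <= T' s) ->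
  Rabs (F x) <= T x.
Proof.
intros Hx F0 T0 HF HT HB. apply Rabs_le. split.
- enough (0 <= F x + T x) by lra.
  apply (nonneg_of_deriv_nonneg (fun s => F s + T s) (fun s => F' s + T' s)); try easy.
  + rewrite F0, T0. ring.
  + intros s Hs. apply (is_derive_plus (K:=R_AbsRing) (V:=R_NormedModule) F); auto.
  + intros s Hs. specialize (HB s Hs). apply Rabs_le_between in HB. lra.
- enough (0 <= T x - F x) by lra.
  apply (nonneg_of_deriv_nonneg (fun s => T s - F s) (fun s => T' s - F' s)); try easy.
  + rewrite F0, T0. ring.
  + intros s Hs. apply (is_derive_minus (K:=R_AbsRing) (V:=R_NormedModule) T); auto.
  + intros s Hs. specialize (HB s Hs). apply Rabs_le_between in HB. lra.
Qed.

(** What is left after the boundary term of an integration by parts; its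
    derivative has the extra factor sin s, which makes it small. *)
Definition cos_quot_rem (m : nat) (x : R) : R :=
  cos_quot_int m x - sin (INR (2 * m + 1) * x) / (INR (2 * m + 1) * cos x).

Lemma cos_quot_rem_0 (m : nat) : cos_quot_rem m 0 = 0.
Proof.
unfold cos_quot_rem. rewrite cos_quot_int_0, Rmult_0_r, sin_0. unfold Rdiv; ring.
Qed.

Lemma cos_quot_rem_derive (m : nat) (s : R) :
  0 < cos s ->
  is_derive (cos_quot_rem m) s
    (- (sin (INR (2 * m + 1) * s) * sin s / (INR (2 * m + 1) * cos s ^ 2))).
Proof.
intros Hc. unfold cos_quot_rem.
assert (EM : 2 * INR m + 1 = INR (2 * m + 1)).
{ rewrite plus_INR, mult_INR. reflexivity. }
assert (HM : 0 < INR (2 * m + 1)) by (apply lt_0_INR; lia).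
set (M := INR (2 * m + 1)) in *. clearbody M.
replace (- _) with (cos ((2 * INR m + 1) * s) / cos s
  + - (cos (M * s) / cos s + sin (M * s) * sin s / (M * cos s ^ 2))).
2: rewrite EM; field; lra.
apply (is_derive_plus (K:=R_AbsRing) (V:=R_NormedModule)
         (cos_quot_int m) (fun x => - (sin (M * x) / (M * cos x)))).
- apply cos_quot_int_derive; lra.
- auto_derive.
  + apply Rgt_not_eq, Rmult_lt_0_compat; lra.
  + field. split; lra.
Qed.

(** Sharp for small x: |sin(Ms)| <= M sin s bounds the derivative by tan^2 s,
    uniformly in M = 2m+1. *)
Lemma cos_quot_rem_bound_tan (m : nat) (x : R) :
  0 <= x < PI / 2 -> Rabs (cos_quot_rem m x) <= tan x - x.
Proof.
intros Hx.
assert (HM : 0 < INR (2 * m + 1)) by (apply lt_0_INR; lia).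
apply (Rabs_le_of_deriv (cos_quot_rem m) (fun s =>
           - (sin (INR (2 * m + 1) * s) * sin s / (INR (2 * m + 1) * cos s ^ 2)))
         (fun s => tan s - s)
         (fun s => sin s ^ 2 / cos s ^ 2)
         x (proj1 Hx) (cos_quot_rem_0 m)).
- rewrite tan_0; ring.
- intros s Hs. apply cos_quot_rem_derive, (cos_pos_of_small x); lra.
- intros s Hs. assert (Hc := cos_pos_of_small x s (proj1 Hx) (proj2 Hx) Hs).
  unfold tan. auto_derive; [lra|].
  field. lra.
- intros s Hs. assert (Hc := cos_pos_of_small x s (proj1 Hx) (proj2 Hx) Hs).
  assert (H := Rabs_sin_INR (2 * m + 1) s).
  set (M := INR (2 * m + 1)) in *. clearbody M.
  assert (Hs0 : 0 <= sin s) by (apply sin_ge_0; lra).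
  rewrite (Rabs_pos_eq (sin s)) in H by easy.
  assert (0 < M * cos s ^ 2) by (apply Rmult_lt_0_compat; [|apply pow_lt]; lra).
  rewrite Rabs_Ropp. unfold Rdiv at 1.
  rewrite !Rabs_mult, (Rabs_pos_eq (sin s)), (Rabs_pos_eq (/ _)); try easy.
  2: now apply Rlt_le, Rinv_0_lt_compat.
  replace (sin s ^ 2 / cos s ^ 2)
    with ((M * sin s) * sin s * / (M * cos s ^ 2)) by (field; lra).
  apply Rmult_le_compat_r; [now apply Rlt_le, Rinv_0_lt_compat|].
  now apply Rmult_le_compat_r.
Qed.

(** Sharp for large Mx, where M = 2m+1: here |sin(Ms)| <= 1 keeps the factor 1/M. *)
Lemma cos_quot_rem_bound_sec (m : nat) (x : R) :
  0 <= x < PI / 2 ->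
  Rabs (cos_quot_rem m x) <= (/ cos x - 1) / INR (2 * m + 1).
Proof.
intros Hx.
assert (HM : 0 < INR (2 * m + 1)) by (apply lt_0_INR; lia).
apply (Rabs_le_of_deriv (cos_quot_rem m) (fun s =>
           - (sin (INR (2 * m + 1) * s) * sin s / (INR (2 * m + 1) * cos s ^ 2)))
         (fun s => (/ cos s - 1) / INR (2 * m + 1))
         (fun s => sin s / (INR (2 * m + 1) * cos s ^ 2))
         x (proj1 Hx) (cos_quot_rem_0 m)).
- rewrite cos_0. field. lra.
- intros s Hs. apply cos_quot_rem_derive, (cos_pos_of_small x); lra.
- intros s Hs. assert (Hc := cos_pos_of_small x s (proj1 Hx) (proj2 Hx) Hs).
  set (M := INR (2 * m + 1)) in *. clearbody M.
  auto_derive; [lra|]. field. lra.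
- intros s Hs. assert (Hc := cos_pos_of_small x s (proj1 Hx) (proj2 Hx) Hs).
  set (M := INR (2 * m + 1)) in *. clearbody M.
  assert (Hs0 : 0 <= sin s) by (apply sin_ge_0; lra).
  assert (0 < M * cos s ^ 2) by (apply Rmult_lt_0_compat; [|apply pow_lt]; lra).
  rewrite Rabs_Ropp. unfold Rdiv.
  rewrite !Rabs_mult, (Rabs_pos_eq (sin s)), (Rabs_pos_eq (/ _)); try easy.
  2: now apply Rlt_le, Rinv_0_lt_compat.
  apply Rmult_le_compat_r; [now apply Rlt_le, Rinv_0_lt_compat|].
  assert (H1 := SIN_bound (M * s)).
  assert (Rabs (sin (M * s)) <= 1) by (apply Rabs_le; lra).
  nra.
Qed.

Lemma sin_le_cubic (u : R) : 0 <= u <= 3 / 2 -> sin u <= u - u ^ 3 / 10.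
Proof.
intros Hu. destruct (pre_sin_bound u 0) as [_ H]; try lra.
eapply Rle_trans; [apply H|].
unfold sin_approx, sin_term; simpl.
assert (0 <= u ^ 3) by (apply pow_le; lra).
assert (0 <= u ^ 3 * (1 / 15 - u ^ 2 / 120)).
{ apply Rmult_le_pos; [easy|]. nra. }
nra.
Qed.

Lemma cos_ge_quadratic (x : R) : 1 - x ^ 2 / 2 <= cos x.
Proof.
replace x with (2 * (x / 2)) at 2 by field.
rewrite cos_2a_sin.
assert (H : Rabs (sin (x / 2)) <= Rabs (x / 2)).
{ destruct (Rle_lt_dec 0 (x / 2)) as [H|H].
  - rewrite (Rabs_pos_eq (x / 2)) by easy.
    destruct (Req_dec (x / 2) 0) as [->|H0]; [rewrite sin_0, Rabs_R0; lra|].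
    assert (H1 := sin_lt_x (x / 2)).
    destruct (Rle_lt_dec (x / 2) 1).
    + rewrite Rabs_pos_eq; [lra|]. apply sin_ge_0; [lra|].
      assert (H2 := PI2_1). lra.
    + assert (H2 := SIN_bound (x / 2)). apply Rabs_le. lra.
  - rewrite (Rabs_left (x / 2)) by easy.
    assert (H1 := sin_gt_x (x / 2)).
    destruct (Rle_lt_dec (-1) (x / 2)).
    + rewrite Rabs_left; [lra|]. apply sin_lt_0_var; [|lra].
      assert (H2 := PI2_1). lra.
    + assert (H2 := SIN_bound (x / 2)). apply Rabs_le. lra. }
apply Rsqr_le_abs_1 in H. unfold Rsqr in H. nra.
Qed.

(** The bound 1/2 sin(2x) is what a variation of total size 2 can afford against
    the leading term sin(2x).  For m = 1 the integral is sin(2x) - x.  For m >= 2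
    the boundary term is sin(Mx)/(M cos x) with M = 2m+1 >= 5: for Mx <= 3/2 its
    cubic defect M^2 x^3/10 outweighs the losses of order x^3 elsewhere, and for
    Mx >= 3/2 the factor 1/M suffices. *)
Lemma cos_quot_int_bound (m : nat) (x : R) :
  (1 <= m)%nat -> 0 <= x < PI / 2 -> sin x <= 1 / 4 ->
  Rabs (cos_quot_int m x) <= sin x * cos x.
Proof.
intros Hm Hx Hs.
assert (Hc : 0 < cos x) by (apply (cos_pos_of_small x); lra).
assert (Hs0 : 0 <= sin x) by (apply sin_ge_0; lra).
assert (E := sin2_cos2 x). unfold Rsqr in E.
(* cos x >= cos^2 x = 1 - sin^2 x >= 15/16 *)
assert (Hc1 : 15 / 16 <= cos x) by nra.
assert (Hc2 := COS_bound x).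
(* The upper bound tan x - x of a modulus is nonnegative. *)
assert (Htan : x <= sin x / cos x).
{ assert (H := cos_quot_rem_bound_tan 0 x Hx).
  assert (H' := Rabs_pos (cos_quot_rem 0 x)). unfold tan in H. lra. }
assert (Hsx : sin x <= x).
{ destruct (Req_dec x 0) as [->|H0]; [rewrite sin_0; lra|].
  apply Rlt_le, sin_lt_x; lra. }
assert (Htan' : x * cos x <= sin x).
{ apply (Rmult_le_compat_r (cos x)) in Htan; [|lra].
  unfold Rdiv in Htan. rewrite Rmult_assoc, Rinv_l, Rmult_1_r in Htan by lra.
  exact Htan. }
destruct (Nat.eq_dec m 1) as [->|Hm1].
- assert (E1 : cos_quot_int 1 x = 2 * sin x * cos x - x).
  { simpl. rewrite Rmult_1_r, sin_2a. field. }
  rewrite E1. apply Rabs_le. nra.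
- assert (HM : 5 <= INR (2 * m + 1)).
  { replace 5 with (INR 5) by (simpl; ring). apply le_INR. lia. }
  assert (HT := cos_quot_rem_bound_tan m x Hx).
  assert (HS := cos_quot_rem_bound_sec m x Hx).
  assert (EA : cos_quot_int m x = cos_quot_rem m x
     + sin (INR (2 * m + 1) * x) / (INR (2 * m + 1) * cos x)).
  { unfold cos_quot_rem. ring. }
  set (M := INR (2 * m + 1)) in *. clearbody M.
  assert (Hpos : 0 < / (M * cos x)).
  { apply Rinv_0_lt_compat, Rmult_lt_0_compat; lra. }
  rewrite EA. eapply Rle_trans; [apply Rabs_triang|].
  unfold Rdiv at 1. rewrite Rabs_mult, (Rabs_pos_eq (/ _)) by lra.
  apply (Rmult_le_reg_r (M * cos x)); [apply Rmult_lt_0_compat; lra|].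
  rewrite Rmult_plus_distr_r, (Rmult_assoc _ (/ _)), Rinv_l, Rmult_1_r
    by (apply Rgt_not_eq, Rmult_lt_0_compat; lra).
  destruct (Rle_lt_dec (M * x) (3 / 2)) as [HMx|HMx].
  + assert (HMx0 : 0 <= M * x) by (apply Rmult_le_pos; lra).
    assert (H1 := sin_le_cubic (M * x) (conj HMx0 HMx)).
    rewrite (Rabs_pos_eq (sin (M * x))).
    2: { apply sin_ge_0; [easy|]. assert (H2 := PI2_3_2). lra. }
    assert (H3 : Rabs (cos_quot_rem m x) * (M * cos x) <= (tan x - x) * (M * cos x)).
    { apply Rmult_le_compat_r; [apply Rmult_le_pos|]; lra. }
    replace ((tan x - x) * (M * cos x)) with (M * (sin x - x * cos x)) in H3
      by (unfold tan; field; lra).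
    assert (H4 : 5 / 2 * x ^ 3 * M <= (M * x) ^ 3 / 10).
    { replace ((M * x) ^ 3 / 10) with (x ^ 3 * M * (M * M / 10)) by field.
      assert (0 <= x ^ 3) by (apply pow_le; lra).
      assert (0 <= x ^ 3 * M) by (apply Rmult_le_pos; lra).
      assert (25 <= M * M) by nra. nra. }
    assert (H5 := cos_ge_quadratic x).
    assert (H6 : sin x ^ 3 <= x ^ 3) by (apply pow_incr; lra).
    assert (H7 : sin x - x * cos x + x - 5 / 2 * x ^ 3 <= sin x * cos x * cos x).
    { replace (sin x * cos x * cos x) with (sin x - sin x ^ 3) by nra.
      assert (x * (1 - x ^ 2 / 2) <= x * cos x) by (apply Rmult_le_compat_l; lra).
      assert (0 <= x ^ 3) by (apply pow_le; lra). nra. }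
    apply (Rmult_le_compat_l M) in H7; [|lra]. lra.
  + assert (H1 := SIN_bound (M * x)).
    assert (H2 : Rabs (sin (M * x)) <= 1) by (apply Rabs_le; lra).
    assert (H3 : Rabs (cos_quot_rem m x) * (M * cos x) <= (/ cos x - 1) / M * (M * cos x)).
    { apply Rmult_le_compat_r; [apply Rmult_le_pos|]; lra. }
    replace ((/ cos x - 1) / M * (M * cos x)) with (1 - cos x) in H3
      by (field; lra).
    assert (H4 : 3 / 2 * cos x <= M * sin x).
    { assert (M * (x * cos x) <= M * sin x) by (apply Rmult_le_compat_l; lra). nra. }
    assert (H5 : 3 / 2 * cos x * (cos x * cos x) <= M * sin x * (cos x * cos x)).
    { apply Rmult_le_compat_r; [nra|lra]. }
    nra.
Qed.

(** * Nonnegativity of the sine sums *)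

(** The properties of b k = k a_k on which positivity rests: b decreases from
    k = 2 on, and the upward increments of k b_k are bounded by those of a
    nondecreasing sequence e with e <= 1.  Hence the positive variation of
    0, 2 b_2, 3 b_3, ..., n b_n, 0 is at most 1 and its total variation at
    most 2. *)
Definition dominated_increments (b e : nat -> R) : Prop :=
  b 1%nat = 1 /\
  (forall k, (2 <= k)%nat -> 0 <= b k /\ b (S k) <= b k) /\
  2 * b 2%nat <= e 2%nat /\
  (forall k, (2 <= k)%nat ->
     e k <= 1 /\ e k <= e (S k) /\
     INR (S k) * b (S k) - INR k * b k <= e (S k) - e k).

Definition sine_sum (b : nat -> R) (m : nat) (t : R) : R :=
  sum_f_R0 (fun j => b (S j) * sin (INR (S j) * t)) m.

Definition sine_tail (b : nat -> R) (m : nat) (t : R) : R :=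
  sum_f_R0 (fun j => b (S (S j)) * sin (INR (S (S j)) * t)) m.

Lemma sine_sum_S (b : nat -> R) (m : nat) (t : R) :
  b 1%nat = 1 -> sine_sum b (S m) t = sin t + sine_tail b m t.
Proof.
intros Hb. unfold sine_sum, sine_tail. rewrite decomp_sum by lia.
cbn [pred]. rewrite Hb. simpl INR at 1. now rewrite !Rmult_1_l.
Qed.

Lemma sine_tail_step (b : nat -> R) (m : nat) (t : R) :
  sine_tail b (S m) t
  = sine_tail b m t + b (S (S (S m))) * sin (INR (S (S (S m))) * t).
Proof. reflexivity. Qed.

(** Away from pi.  Since 2 sin x sin(2kx) = cos((2k-1)x) - cos((2k+1)x), summation
    by parts leaves b_2 cos(3x) and the decrements of b, which add up to b_2 when
    the last one is taken to 0, each multiplied by a factor at least -1. *)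
Lemma sine_tail_ge_decreasing (b : nat -> R) (m : nat) (x : R) :
  (forall k, (2 <= k)%nat -> 0 <= b k /\ b (S k) <= b k) ->
  b 2%nat * (cos (3 * x) - 1) <= 2 * sin x * sine_tail b m (2 * x).
Proof.
intros Hb.
assert (HC : forall k, 2 * sin x * sin (INR k * (2 * x))
  = cos ((2 * INR k - 1) * x) - cos ((2 * INR k + 1) * x)).
{ intros k.
  replace ((2 * INR k - 1) * x) with (INR k * (2 * x) - x) by ring.
  replace ((2 * INR k + 1) * x) with (INR k * (2 * x) + x) by ring.
  rewrite cos_plus, cos_minus. ring. }
enough (H : b 2%nat * (cos (3 * x) - 1)
    + b (S (S m)) * (1 - cos ((2 * INR (S (S m)) + 1) * x))
  <= 2 * sin x * sine_tail b m (2 * x)).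
{ destruct (Hb (S (S m))) as [H0 _]; [lia|].
  assert (H1 := COS_bound ((2 * INR (S (S m)) + 1) * x)).
  assert (0 <= b (S (S m)) * (1 - cos ((2 * INR (S (S m)) + 1) * x)))
    by (apply Rmult_le_pos; lra).
  lra. }
induction m as [|m IH].
- unfold sine_tail. cbn [sum_f_R0].
  replace (2 * sin x * (b 2%nat * sin (INR 2 * (2 * x))))
    with (b 2%nat * (2 * sin x * sin (INR 2 * (2 * x)))) by ring.
  rewrite HC. replace (2 * INR 2 - 1) with 3 by (simpl; ring).
  apply Req_le. ring.
- rewrite sine_tail_step, Rmult_plus_distr_l.
  set (k := S (S m)) in *.
  replace (2 * sin x * (b (S k) * sin (INR (S k) * (2 * x))))
    with (b (S k) * (2 * sin x * sin (INR (S k) * (2 * x)))) by ring.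
  rewrite HC.
  replace (2 * INR (S k) - 1) with (2 * INR k + 1) by (rewrite S_INR; ring).
  destruct (Hb k) as [H0 H1]; [unfold k; lia|].
  assert (H2 := COS_bound ((2 * INR k + 1) * x)).
  assert (b (S k) * (1 - cos ((2 * INR k + 1) * x))
          <= b k * (1 - cos ((2 * INR k + 1) * x))).
  { apply Rmult_le_compat_r; lra. }
  lra.
Qed.

Lemma trig_INR_PI_minus (n : nat) (y : R) :
  cos (INR n * (PI - y)) = (-1) ^ n * cos (INR n * y) /\
  sin (INR n * (PI - y)) = - ((-1) ^ n * sin (INR n * y)).
Proof.
induction n as [|n [IHc IHs]].
- simpl. rewrite !Rmult_0_l, cos_0, sin_0. split; ring.
- rewrite S_INR, !Rmult_plus_distr_r, !Rmult_1_l.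
  rewrite !cos_plus, !sin_plus, IHc, IHs, Rtrigo_facts.cos_pi_minus, sin_PI_x.
  simpl. split; ring.
Qed.

(** The signs turn the sum of consecutive integrals into a difference, as needed
    for a summation by parts at the angle pi - 2x. *)
Definition signed_cos_quot_int (m : nat) (x : R) : R :=
  (-1) ^ m * cos_quot_int m x.

Lemma sin_eq_signed_difference (k : nat) (x : R) :
  sin (INR (S k) * (PI - 2 * x))
  = INR (S k) * (signed_cos_quot_int k x - signed_cos_quot_int (S k) x).
Proof.
rewrite (proj2 (trig_INR_PI_minus (S k) (2 * x))).
unfold signed_cos_quot_int. cbn [cos_quot_int].
replace (2 * INR (S k) * x) with (INR (S k) * (2 * x)) by ring.
assert (H : INR (S k) <> 0) by (apply not_0_INR; lia).
cbn [pow]. field. easy.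
Qed.

(** Near pi.  Summation by parts expresses the tail through the differences of
    k b_k (including those to 0 at both ends) times integrals of absolute value at
    most 1/2 sin(2x); the total variation is at most 2.  The induction carries the
    variation up to k in the form 2 e_k - k b_k: twice the upward variation minus
    the final value. *)
Lemma sine_tail_ge_variation (b e : nat -> R) (m : nat) (x : R) :
  dominated_increments b e -> 0 <= x < PI / 2 -> sin x <= 1 / 4 ->
  - sin (2 * x) <= sine_tail b m (PI - 2 * x).
Proof.
intros (_ & Hb & Hb2 & He) Hx Hs.
set (q := sin x * cos x).
assert (Hg : forall k, (1 <= k)%nat -> - q <= signed_cos_quot_int k x <= q).
{ intros k Hk. apply Rabs_le_between. unfold signed_cos_quot_int.
  rewrite Rabs_mult, pow_1_abs, Rmult_1_l. now apply cos_quot_int_bound. }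
assert (Hq : 0 <= q) by (specialize (Hg 1%nat (le_n _)); lra).
assert (H : - q * (2 * e (S (S m)) - INR (S (S m)) * b (S (S m)))
   <= sine_tail b m (PI - 2 * x)
      + INR (S (S m)) * b (S (S m)) * signed_cos_quot_int (S (S m)) x).
{ induction m as [|m IH].
  - unfold sine_tail. cbn [sum_f_R0]. rewrite sin_eq_signed_difference.
    replace (INR 2) with 2 by (simpl; ring).
    destruct (Hb 2%nat) as [H0 _]; [lia|].
    specialize (Hg 1%nat (le_n _)).
    assert (q * (2 * b 2%nat) <= q * e 2%nat) by (apply Rmult_le_compat_l; lra).
    assert (b 2%nat * - q <= b 2%nat * signed_cos_quot_int 1 x)
      by (apply Rmult_le_compat_l; lra).
    lra.
  - rewrite sine_tail_step, sin_eq_signed_difference.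
    set (k := S (S m)) in *.
    destruct (He k) as (_ & H1 & H2); [unfold k; lia|].
    specialize (Hg k ltac:(unfold k; lia)).
    set (D := INR k * b k) in *. set (g := signed_cos_quot_int k x) in *.
    (* |d| = 2 max(d, 0) - d for the increment d of k b_k. *)
    assert (H3 : - q * (2 * (e (S k) - e k) - (INR (S k) * b (S k) - D))
        <= (INR (S k) * b (S k) - D) * g).
    { destruct (Rle_lt_dec D (INR (S k) * b (S k))).
      - assert ((INR (S k) * b (S k) - D) * - q <= (INR (S k) * b (S k) - D) * g)
          by (apply Rmult_le_compat_l; lra).
        assert (q * (INR (S k) * b (S k) - D) <= q * (e (S k) - e k))
          by (apply Rmult_le_compat_l; lra).
        lra.
      - assert ((D - INR (S k) * b (S k)) * g <= (D - INR (S k) * b (S k)) * q)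
          by (apply Rmult_le_compat_l; lra).
        assert (0 <= q * (e (S k) - e k)) by (apply Rmult_le_pos; lra).
        lra. }
    lra. }
destruct (He (S (S m))) as [H1 _]; [lia|].
destruct (Hb (S (S m))) as [H0 _]; [lia|].
specialize (Hg (S (S m)) ltac:(lia)).
assert (HD : 0 <= INR (S (S m)) * b (S (S m)))
  by (apply Rmult_le_pos; [apply pos_INR|easy]).
set (D := INR (S (S m)) * b (S (S m))) in *.
assert (D * signed_cos_quot_int (S (S m)) x <= D * q)
  by (apply Rmult_le_compat_l; lra).
assert (q * e (S (S m)) <= q * 1) by (apply Rmult_le_compat_l; lra).
rewrite sin_2a. fold q in H. unfold q in *. lra.
Qed.

(** The two tail bounds overlap.  With y = cos(t/2) and b_2 <= 1/2, the first one
    needs (1 - y)(4y^2 + 4y - 1) >= 0, that is y >= (sqrt 2 - 1)/2, about 0.207; the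
    second one holds for y <= 1/4. *)
Lemma sine_sum_nonneg (b e : nat -> R) (m : nat) (t : R) :
  dominated_increments b e -> 0 < t < PI -> 0 <= sine_sum b m t.
Proof.
intros Hbe Ht. assert (Hbe' := Hbe). destruct Hbe' as (Hb1 & Hb & Hb2 & He).
assert (Hst : 0 < sin t) by (apply sin_gt_0; lra).
destruct m as [|m].
{ unfold sine_sum. simpl. rewrite Hb1, !Rmult_1_l. lra. }
rewrite sine_sum_S by easy.
destruct (Rle_lt_dec (cos (t / 2)) (1 / 4)) as [Hc|Hc].
- set (x := PI / 2 - t / 2).
  assert (H := sine_tail_ge_variation b e m x Hbe).
  replace (PI - 2 * x) with t in H by (unfold x; field).
  replace (2 * x) with (PI - t) in H by (unfold x; field).
  rewrite sin_PI_x in H. unfold x in H at 3. rewrite sin_shift in H.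
  assert (0 <= x < PI / 2) by (unfold x; lra).
  specialize (H H0 Hc). lra.
- set (y := t / 2) in *.
  assert (Et : t = 2 * y) by (unfold y; field).
  assert (Hs : 0 < sin y) by (apply sin_gt_0; unfold y; lra).
  assert (H := sine_tail_ge_decreasing b m y Hb).
  rewrite <- Et in H.
  assert (E3 : cos (3 * y) = 4 * cos y ^ 3 - 3 * cos y).
  { replace (3 * y) with (2 * y + y) by ring.
    rewrite cos_plus, cos_2a, sin_2a.
    assert (E := sin2_cos2 y). unfold Rsqr in E.
    replace (sin y * sin y) with (1 - cos y * cos y) by lra.
    replace (2 * sin y * cos y * sin y) with (2 * cos y * (sin y * sin y)) by ring.
    replace (sin y * sin y) with (1 - cos y * cos y) by lra. ring. }
  assert (Hb2' : b 2%nat <= 1 / 2) by (destruct (He 2%nat) as [H1 _]; [lia|lra]).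
  assert (H3 := COS_bound (3 * y)). assert (H4 := COS_bound y).
  assert (H5 : 1 / 2 * (cos (3 * y) - 1) <= b 2%nat * (cos (3 * y) - 1)) by nra.
  assert (H6 : 1 - cos (3 * y) <= 2 * (2 * sin y * sin t)).
  { rewrite Et, sin_2a, E3.
    replace (2 * (2 * sin y * (2 * sin y * cos y)))
      with (8 * cos y * (sin y * sin y)) by ring.
    assert (E := sin2_cos2 y). unfold Rsqr in E.
    replace (sin y * sin y) with (1 - cos y * cos y) by lra.
    assert (0 <= (1 - cos y) * (4 * cos y ^ 2 + 4 * cos y - 1)).
    { apply Rmult_le_pos; [lra|]. nra. }
    lra. }
  apply (Rmult_le_reg_l (2 * sin y)); [lra|]. lra.
Qed.

(** The real part of (1 - z^2) times the sum of b_(j+1) z^j on the unit circle. *)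
Definition cos_poly (b : nat -> R) (m : nat) (t : R) : R :=
  sum_f_R0 (fun j => b (S j) * (cos (INR j * t) - cos (INR (S (S j)) * t))) m.

Lemma cos_poly_sine_sum (b : nat -> R) (m : nat) (t : R) :
  cos_poly b m t = 2 * sin t * sine_sum b m t.
Proof.
unfold cos_poly, sine_sum. rewrite scal_sum. apply sum_eq. intros j _.
replace (INR j * t) with (INR (S j) * t - t) by (rewrite S_INR; ring).
replace (INR (S (S j)) * t) with (INR (S j) * t + t) by (rewrite (S_INR (S j)); ring).
rewrite cos_plus, cos_minus. ring.
Qed.

Lemma cos_INR_congr (s t : R) : cos s = cos t ->
  forall n, cos (INR n * s) = cos (INR n * t).
Proof.
intros E n.
enough (cos (INR n * s) = cos (INR n * t)
        /\ cos (INR (S n) * s) = cos (INR (S n) * t)) by easy.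
assert (rec : forall k u, cos (INR (S (S k)) * u)
   = 2 * cos u * cos (INR (S k) * u) - cos (INR k * u)).
{ intros k u.
  replace (INR (S (S k)) * u) with (INR (S k) * u + u) by (rewrite (S_INR (S k)); ring).
  replace (INR k * u) with (INR (S k) * u - u) by (rewrite S_INR; ring).
  rewrite cos_plus, cos_minus. ring. }
induction n as [|n [IH1 IH2]].
- simpl. rewrite !Rmult_0_l, !Rmult_1_l. easy.
- split; [easy|]. rewrite !rec. now rewrite E, IH1, IH2.
Qed.

(** The polynomial depends on t only through cos t, which reduces every real t to
    the range from 0 to pi. *)
Lemma cos_poly_nonneg (b e : nat -> R) (m : nat) (t : R) :
  dominated_increments b e -> 0 <= cos_poly b m t.
Proof.
intros Hbe. set (s := acos (cos t)).
assert (Es : cos s = cos t) by (apply cos_acos, COS_bound).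
replace (cos_poly b m t) with (cos_poly b m s).
2: { apply sum_eq. intros j _. now rewrite !(cos_INR_congr s t Es). }
rewrite cos_poly_sine_sum.
destruct (acos_bound (cos t)) as [H0 H1]. fold s in H0, H1.
destruct (Req_dec s 0) as [->|N0]; [rewrite sin_0; lra|].
destruct (Req_dec s PI) as [->|N1]; [rewrite sin_PI; lra|].
apply Rmult_le_pos.
- assert (0 < sin s) by (apply sin_gt_0; lra). lra.
- apply (sine_sum_nonneg b e); [easy|lra].
Qed.

(** * From the unit circle to the disk *)

Definition poisson_kernel (r t : R) : R :=
  (1 - r ^ 2) / (1 - 2 * r * cos t + r ^ 2).

Lemma poisson_denominator_ge (r t : R) :
  0 <= r -> (1 - r) ^ 2 <= 1 - 2 * r * cos t + r ^ 2.
Proof. intros Hr. assert (H := COS_bound t). nra. Qed.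

Lemma poisson_denominator_le (r t : R) :
  0 <= r -> 1 - 2 * r * cos t + r ^ 2 <= (1 + r) ^ 2.
Proof. intros Hr. assert (H := COS_bound t). nra. Qed.

Lemma poisson_kernel_ge (r t : R) :
  0 <= r < 1 -> (1 - r) / (1 + r) <= poisson_kernel r t.
Proof.
intros Hr. unfold poisson_kernel.
assert (H1 := poisson_denominator_ge r t (proj1 Hr)).
assert (H2 := poisson_denominator_le r t (proj1 Hr)).
assert (0 < (1 - r) ^ 2) by (apply pow_lt; lra).
replace ((1 - r) / (1 + r)) with ((1 - r ^ 2) * / (1 + r) ^ 2) by (field; lra).
apply Rmult_le_compat_l; [nra|]. apply Rinv_le_contravar; lra.
Qed.

Lemma poisson_kernel_le (r t : R) :
  0 <= r < 1 -> poisson_kernel r t <= (1 + r) / (1 - r).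
Proof.
intros Hr. unfold poisson_kernel.
assert (H1 := poisson_denominator_ge r t (proj1 Hr)).
assert (0 < (1 - r) ^ 2) by (apply pow_lt; lra).
replace ((1 + r) / (1 - r)) with ((1 - r ^ 2) * / (1 - r) ^ 2) by (field; lra).
apply Rmult_le_compat_l; [nra|]. apply Rinv_le_contravar; lra.
Qed.

Lemma poisson_kernel_nonneg (r t : R) : 0 <= r < 1 -> 0 <= poisson_kernel r t.
Proof.
intros Hr. eapply Rle_trans; [|now apply poisson_kernel_ge].
apply Rmult_le_pos; [lra|]. apply Rlt_le, Rinv_0_lt_compat; lra.
Qed.

Lemma is_RInt_eq_R (f g : R -> R) (a b l l' : R) :
  is_RInt f a b l -> (forall t, f t = g t) -> l = l' -> is_RInt g a b l'.
Proof. intros H E <-. revert H. apply is_RInt_ext. intros t _. apply E. Qed.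

Lemma is_RInt_value_R (f g : R -> R) (a b l k : R) :
  is_RInt f a b l -> is_RInt g a b k -> (forall t, f t = g t) -> l = k.
Proof.
intros Hf Hg E.
assert (H : is_RInt g a b l) by (now apply (is_RInt_eq_R f g a b l)).
rewrite <- (is_RInt_unique (V:=R_CompleteNormedModule) g a b l H).
exact (is_RInt_unique (V:=R_CompleteNormedModule) g a b k Hg).
Qed.

Lemma is_RInt_lin2 (f g : R -> R) (a b u v l k : R) :
  is_RInt f a b l -> is_RInt g a b k ->
  is_RInt (fun t => u * f t + v * g t) a b (u * l + v * k).
Proof.
intros Hf Hg. apply (is_RInt_plus (V:=R_NormedModule)).
- now apply (is_RInt_scal (V:=R_NormedModule)).
- now apply (is_RInt_scal (V:=R_NormedModule)).
Qed.

Lemma ex_RInt_poisson_cos (r w k : R) :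
  0 <= r < 1 ->
  ex_RInt (fun t => poisson_kernel r t * cos (k * t + w)) 0 (2 * PI).
Proof.
intros Hr. apply (ex_RInt_continuous (V:=R_CompleteNormedModule)).
intros t _. apply (ex_derive_continuous (V:=R_NormedModule)).
unfold poisson_kernel. auto_derive.
assert (H1 := poisson_denominator_ge r t (proj1 Hr)).
assert (0 < (1 - r) ^ 2) by (apply pow_lt; lra).
simpl in *. lra.
Qed.

Lemma is_RInt_cos_INR (j : nat) (w : R) :
  is_RInt (fun t => cos (INR j * t + w)) 0 (2 * PI) (2 * PI * 0 ^ j * cos w).
Proof.
destruct j as [|j].
- apply (is_RInt_ext (fun _ => cos w)).
  + intros t _. simpl. now rewrite Rmult_0_l, Rplus_0_l.
  + replace (2 * PI * 0 ^ 0 * cos w) with (scal (2 * PI - 0) (cos w)).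
    * apply (is_RInt_const (V:=R_NormedModule)).
    * unfold scal; simpl; unfold mult; simpl. ring.
- assert (Hn : INR (S j) <> 0) by (apply not_0_INR; lia).
  set (F := fun t => sin (INR (S j) * t + w) / INR (S j)).
  replace (2 * PI * 0 ^ S j * cos w) with (minus (F (2 * PI)) (F 0)).
  + apply (is_RInt_derive (V:=R_CompleteNormedModule) F).
    * intros t _. unfold F. set (n := INR (S j)) in *. clearbody n.
      auto_derive; [easy|]. now field.
    * intros t _. apply (ex_derive_continuous (V:=R_NormedModule)). auto_derive. easy.
  + change (@eq R (F (2 * PI) - F 0) (2 * PI * 0 ^ S j * cos w)). unfold F.
    replace (INR (S j) * (2 * PI) + w) with (w + 2 * INR (S j) * PI) by ring.
    rewrite sin_period, Rmult_0_r, Rplus_0_l, pow_i by lia. ring.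
Qed.

(** Let I_j be the integral.  Multiplying the kernel by its denominator gives
    r I_(j+2) = (1 + r^2) I_(j+1) - r I_j, so the deviations I_(j+1) - r I_j grow
    like r^(-j); the I_j being bounded, they vanish, and I_j = r^j I_0.  The
    recurrence at j = 0 determines I_0. *)
Lemma is_RInt_poisson_cos (r w : R) (j : nat) :
  0 <= r < 1 ->
  is_RInt (fun t => poisson_kernel r t * cos (INR j * t + w)) 0 (2 * PI)
    (2 * PI * r ^ j * cos w).
Proof.
intros Hr.
destruct (Req_dec r 0) as [->|Hr0].
{ apply (is_RInt_eq_R _ _ _ _ _ _ (is_RInt_cos_INR j w)); [|easy].
  intros t. unfold poisson_kernel. field. }
set (I := fun (w : R) (k : nat) =>
  RInt (fun t => poisson_kernel r t * cos (INR k * t + w)) 0 (2 * PI) : R).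
assert (HI : forall w k, is_RInt
   (fun t => poisson_kernel r t * cos (INR k * t + w)) 0 (2 * PI) (I w k)).
{ intros w' k. apply (RInt_correct (V:=R_CompleteNormedModule)).
  now apply ex_RInt_poisson_cos. }
assert (rec : forall w k, r * I w (S (S k)) = (1 + r ^ 2) * I w (S k) - r * I w k).
{ intros w' k.
  assert (H1 := is_RInt_lin2 _ _ _ _ (1 + r ^ 2) (- r) _ _ (HI w' (S k)) (HI w' k)).
  assert (H2 := is_RInt_lin2 _ _ _ _ r (1 - r ^ 2) _ _
                  (HI w' (S (S k))) (is_RInt_cos_INR (S k) w')).
  assert (E := is_RInt_value_R _ _ _ _ _ _ H1 H2).
  rewrite pow_i in E by lia.
  enough (forall t, (1 + r ^ 2) * (poisson_kernel r t * cos (INR (S k) * t + w')) +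
      - r * (poisson_kernel r t * cos (INR k * t + w')) =
      r * (poisson_kernel r t * cos (INR (S (S k)) * t + w')) +
      (1 - r ^ 2) * cos (INR (S k) * t + w')) by (specialize (E H); lra).
  intros t.
  assert (Hd := poisson_denominator_ge r t (proj1 Hr)).
  assert (0 < (1 - r) ^ 2) by (apply pow_lt; lra).
  replace (INR (S (S k)) * t + w') with ((INR (S k) * t + w') + t)
    by (rewrite (S_INR (S k)); ring).
  replace (INR k * t + w') with ((INR (S k) * t + w') - t) by (rewrite S_INR; ring).
  set (A := INR (S k) * t + w').
  rewrite (cos_plus A), (cos_minus A). unfold poisson_kernel. field. lra. }
assert (bnd : forall w k, Rabs (I w k) <= 2 * PI * ((1 + r) / (1 - r))).
{ intros w' k. replace (2 * PI) with (2 * PI - 0) by ring.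
  apply abs_RInt_le_const.
  - assert (H := PI_RGT_0). lra.
  - now apply ex_RInt_poisson_cos.
  - intros t _. rewrite Rabs_mult, Rabs_pos_eq by now apply poisson_kernel_nonneg.
    assert (H1 := COS_bound (INR k * t + w')).
    assert (H2 : Rabs (cos (INR k * t + w')) <= 1) by (apply Rabs_le; lra).
    assert (H3 := poisson_kernel_le r t Hr).
    assert (H4 := poisson_kernel_nonneg r t Hr). nra. }
assert (geo : forall w k, r ^ k * (I w (S k) - r * I w k) = I w 1%nat - r * I w 0%nat).
{ intros w' k. induction k as [|k IH]; [simpl; ring|].
  rewrite <- IH, <- tech_pow_Rmult. specialize (rec w' k).
  replace (r * r ^ k * (I w' (S (S k)) - r * I w' (S k)))
    with (r ^ k * (r * I w' (S (S k)) - r ^ 2 * I w' (S k))) by ring.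
  rewrite rec. ring. }
assert (E0 : forall w, I w 1%nat - r * I w 0%nat = 0).
{ intros w'. apply cond_eq. intros eps Heps. rewrite Rminus_0_r.
  set (B := 2 * (2 * PI * ((1 + r) / (1 - r))) + 1).
  assert (HB : 0 < B).
  { assert (H := bnd w' 0%nat). assert (H' := Rabs_pos (I w' 0%nat)). unfold B. lra. }
  destruct (pow_lt_1_zero r) with (y := eps / B) as [N HN].
  { rewrite Rabs_pos_eq; lra. }
  { now apply Rdiv_lt_0_compat. }
  rewrite <- (geo w' N), Rabs_mult.
  specialize (HN N (le_n _)).
  assert (H1 : Rabs (I w' (S N) - r * I w' N) <= B).
  { unfold Rminus. eapply Rle_trans; [apply Rabs_triang|].
    rewrite Rabs_Ropp, Rabs_mult, (Rabs_pos_eq r) by lra.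
    assert (H2 := bnd w' N). assert (H3 := bnd w' (S N)).
    assert (H4 := Rabs_pos (I w' N)). unfold B. nra. }
  apply Rle_lt_trans with (Rabs (r ^ N) * B).
  - apply Rmult_le_compat_l; [apply Rabs_pos|easy].
  - apply Rmult_lt_reg_r with (/ B); [now apply Rinv_0_lt_compat|].
    rewrite Rmult_assoc, Rinv_r, Rmult_1_r by lra. exact HN. }
assert (pw : forall w k, I w k = r ^ k * I w 0%nat).
{ intros w' k. induction k as [|k IH]; [simpl; ring|].
  assert (H := geo w' k). rewrite E0 in H.
  assert (H0 : r ^ k <> 0) by now apply pow_nonzero.
  apply Rmult_integral in H. destruct H as [H|H]; [easy|].
  simpl. rewrite Rmult_assoc, <- IH. lra. }
assert (J : I 0 0%nat = 2 * PI).
{ assert (H1 := is_RInt_lin2 _ _ _ _ (1 + r ^ 2) (- (2 * r)) _ _ (HI 0 0%nat) (HI 0 1%nat)).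
  assert (H2 := is_RInt_lin2 _ _ _ _ (1 - r ^ 2) 0 _ _
                  (is_RInt_cos_INR 0 0) (is_RInt_cos_INR 0 0)).
  assert (E := is_RInt_value_R _ _ _ _ _ _ H1 H2).
  rewrite (pw 0 1%nat), cos_0 in E.
  assert (0 < 1 - r ^ 2) by nra.
  apply (Rmult_eq_reg_l (1 - r ^ 2)); [|lra].
  enough (forall t, (1 + r ^ 2) * (poisson_kernel r t * cos (INR 0 * t + 0)) +
      - (2 * r) * (poisson_kernel r t * cos (INR 1 * t + 0)) =
      (1 - r ^ 2) * cos (INR 0 * t + 0) + 0 * cos (INR 0 * t + 0))
    by (specialize (E H0); simpl in *; lra).
  intros t.
  assert (Hd := poisson_denominator_ge r t (proj1 Hr)).
  assert (0 < (1 - r) ^ 2) by (apply pow_lt; lra).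
  simpl INR. rewrite Rmult_0_l, Rmult_1_l, !Rplus_0_r, cos_0.
  unfold poisson_kernel. field. lra. }
apply (is_RInt_eq_R _ _ _ _ _ _ (HI w j)); [easy|].
rewrite pw. replace (I w 0%nat) with (cos w * I 0 0%nat); [rewrite J; ring|].
assert (H1 := is_RInt_lin2 _ _ _ _ (cos w) 0 _ _ (HI 0 0%nat) (HI 0 0%nat)).
assert (E := is_RInt_value_R _ _ _ _ _ _ H1 (HI w 0%nat)).
rewrite Rmult_0_l, Rplus_0_r in E. apply E.
intros t. simpl INR. rewrite Rmult_0_l, !Rplus_0_l, cos_0. ring.
Qed.

Definition cos_poly_polar (b : nat -> R) (m : nat) (r w : R) : R :=
  sum_f_R0 (fun j => b (S j) *
    (r ^ j * cos (INR j * w) - r ^ S (S j) * cos (INR (S (S j)) * w))) m.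

Lemma is_RInt_poisson_cos_poly (b : nat -> R) (m : nat) (r w : R) :
  0 <= r < 1 ->
  is_RInt (fun t => poisson_kernel r t * cos_poly b m (t + w)) 0 (2 * PI)
    (2 * PI * cos_poly_polar b m r w).
Proof.
intros Hr.
assert (term : forall j, is_RInt (fun t => poisson_kernel r t *
    (b (S j) * (cos (INR j * (t + w)) - cos (INR (S (S j)) * (t + w))))) 0 (2 * PI)
    (2 * PI * (b (S j) *
      (r ^ j * cos (INR j * w) - r ^ S (S j) * cos (INR (S (S j)) * w))))).
{ intros j.
  assert (H1 := is_RInt_poisson_cos r (INR j * w) j Hr).
  assert (H2 := is_RInt_poisson_cos r (INR (S (S j)) * w) (S (S j)) Hr).
  apply (is_RInt_eq_R _ _ _ _ _ _
           (is_RInt_lin2 _ _ _ _ (b (S j)) (- b (S j)) _ _ H1 H2)); [|ring].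
  intros t. rewrite !Rmult_plus_distr_l. ring. }
unfold cos_poly, cos_poly_polar. induction m as [|m IH].
- apply term.
- apply (is_RInt_eq_R _ _ _ _ _ _ (is_RInt_lin2 _ _ _ _ 1 1 _ _ IH (term (S m)))).
  + intros t. rewrite tech5. ring.
  + rewrite tech5. ring.
Qed.

(** At r = 0 the Poisson integral is the plain mean over the circle, and the
    convention 0 ^ 0 = 1 keeps exactly the constant term. *)
Lemma cos_poly_polar_0 (b : nat -> R) (m : nat) (w : R) :
  cos_poly_polar b m 0 w = b 1%nat.
Proof.
unfold cos_poly_polar. induction m as [|m IH].
- simpl. rewrite Rmult_0_l, cos_0. ring.
- rewrite tech5, IH, !pow_i by lia. ring.
Qed.

(** Harnack's inequality.  A bound that is independent of m is needed for the
    strict inequality to survive the limit of the partial sums. *)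
Lemma cos_poly_polar_ge (b e : nat -> R) (m : nat) (r w : R) :
  dominated_increments b e -> 0 <= r < 1 -> (1 - r) / (1 + r) <= cos_poly_polar b m r w.
Proof.
intros Hbe Hr.
assert (H1 := is_RInt_poisson_cos_poly b m r w Hr).
assert (H2 := is_RInt_poisson_cos_poly b m 0 w ltac:(lra)).
rewrite cos_poly_polar_0, (proj1 Hbe) in H2.
assert (H3 := is_RInt_lin2 _ _ _ _ ((1 - r) / (1 + r)) 0 _ _ H2 H2).
assert (HPI := PI_RGT_0).
apply (Rmult_le_reg_l (2 * PI)); [lra|].
replace (2 * PI * ((1 - r) / (1 + r)))
  with ((1 - r) / (1 + r) * (2 * PI * 1) + 0 * (2 * PI * 1)) by ring.
assert (Hle : 0 <= 2 * PI) by lra.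
apply (is_RInt_le _ _ _ _ _ _ Hle H3 H1).
intros t _.
assert (H4 := cos_poly_nonneg b e m (t + w) Hbe).
assert (H5 := poisson_kernel_ge r t Hr).
(* The kernel for r = 0 is constant, so the second integral is the mean. *)
replace (poisson_kernel 0 t) with 1 by (unfold poisson_kernel; field).
rewrite Rmult_1_l, Rmult_0_l, Rplus_0_r. now apply Rmult_le_compat_r.
Qed.

(** * Complex derivatives of power sums *)

(** Every derivative below comes from an explicit quadratic remainder estimate,
    which for power sums is uniform in the number of terms. *)
Lemma is_C_derive_of_quadratic (F : C -> C) (z l : C) (d M : R) :
  0 < d -> 0 <= M ->
  (forall h : C, Cmod h < d -> Cmod (F (z + h) - F z - h * l)%C <= M * Cmod h ^ 2) ->
  @is_derive C_AbsRing C_NormedModule F z l.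
Proof.
intros Hd HM H. split.
- apply (@is_linear_scal_l C_AbsRing C_NormedModule).
- intros x Hx.
  apply (is_filter_lim_locally_unique (K:=C_AbsRing) (V:=AbsRing_NormedModule C_AbsRing)) in Hx.
  rewrite <- Hx. intros eps.
  assert (Hd' : 0 < Rmin d (eps / (M + 1))).
  { apply Rmin_glb_lt; [easy|]. apply Rdiv_lt_0_compat; [apply eps|lra]. }
  exists (mkposreal _ Hd'). intros y Hy.
  change (Cmod (y - z)%C < Rmin d (eps / (M + 1))) in Hy.
  change (Cmod ((F y - F z) - (y - z) * l)%C <= eps * Cmod (y - z)%C).
  assert (H1 := Rmin_l d (eps / (M + 1))). assert (H2 := Rmin_r d (eps / (M + 1))).
  specialize (H (y - z)%C ltac:(lra)).
  assert (E : forall v : C, (z + (v - z))%C = v) by (intros v; ring).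
  rewrite E in H.
  eapply Rle_trans; [apply H|].
  assert (H3 := Cmod_ge_0 (y - z)%C).
  assert (H4 : (M + 1) * Cmod (y - z)%C <= eps).
  { apply (Rmult_le_reg_r (/ (M + 1))); [apply Rinv_0_lt_compat; lra|].
    replace ((M + 1) * Cmod (y - z)%C * / (M + 1)) with (Cmod (y - z)%C)
      by (field; lra).
    unfold Rdiv in *. lra. }
  nra.
Qed.

Definition Ccvg (u : nat -> C) (l : C) : Prop :=
  forall eps, 0 < eps -> exists N, forall n, (N <= n)%nat -> Cmod (u n - l)%C < eps.

Lemma Ccvg_series (u : nat -> C) (l : C) :
  @is_series C_AbsRing C_NormedModule u l ->
  Ccvg (@sum_n C_AbelianGroup u) l.
Proof.
intros H eps Heps.
assert (H' := proj1 (@filterlim_locally_ball_norm C_AbsRing nat C_NormedModule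
  eventually _ _ l) H (mkposreal eps Heps)).
destruct H' as [N HN]. exists N. intros n Hn. specialize (HN n Hn).
exact HN.
Qed.

(** With E_k the remainder for the exponent k,
    E_(k+1) = (z + h) E_k + k h^2 z^(k-1). *)
Lemma Cmod_power_taylor_le (z h : C) (rho : R) (j : nat) :
  Cmod z <= rho -> Cmod (z + h)%C <= rho ->
  Cmod ((z + h) ^ S (S j) - z ^ S (S j) - h * (RtoC (INR (S (S j))) * z ^ S j))%C
  <= INR (S (S j)) ^ 2 * rho ^ j * Cmod h ^ 2.
Proof.
intros Hz Hzh. assert (H0 := Cmod_ge_0 z). assert (Hh := Cmod_ge_0 h).
induction j as [|j IH].
- replace ((z + h) ^ 2 - z ^ 2 - h * (RtoC (INR 2) * z ^ 1))%C with (h * h)%C.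
  + rewrite Cmod_mult. simpl. nra.
  + simpl INR. rewrite RtoC_plus. simpl. ring.
- set (k := S (S j)) in *.
  replace ((z + h) ^ S k - z ^ S k - h * (RtoC (INR (S k)) * z ^ k))%C
    with ((z + h) * ((z + h) ^ k - z ^ k - h * (RtoC (INR k) * z ^ S j))
      + RtoC (INR k) * (h * h) * z ^ S j)%C.
  2: { rewrite (S_INR k), RtoC_plus. unfold k. simpl Cpow. ring. }
  eapply Rle_trans; [apply Cmod_triangle|].
  rewrite !Cmod_mult, Cmod_R, Cmod_pow, (Rabs_pos_eq (INR k)) by apply pos_INR.
  assert (Hp : Cmod z ^ S j <= rho ^ S j) by (apply pow_incr; lra).
  assert (Hk := pos_INR k).
  assert (Hr : 0 <= rho ^ S j) by (apply pow_le; lra).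
  assert (E1 : Cmod (z + h)%C * Cmod ((z + h) ^ k - z ^ k - h * (RtoC (INR k) * z ^ S j))%C
    <= rho * (INR k ^ 2 * rho ^ j * Cmod h ^ 2)).
  { apply Rmult_le_compat; try apply Cmod_ge_0; easy. }
  assert (E2 : INR k * (Cmod h * Cmod h) * Cmod z ^ S j
    <= INR k * (Cmod h * Cmod h) * rho ^ S j).
  { apply Rmult_le_compat_l; [|easy]. apply Rmult_le_pos; [easy|]. nra. }
  eapply Rle_trans; [apply Rplus_le_compat; [apply E1|apply E2]|].
  rewrite (S_INR k).
  replace (rho * (INR k ^ 2 * rho ^ j * Cmod h ^ 2) + INR k * (Cmod h * Cmod h) * rho ^ S j)
    with ((INR k ^ 2 + INR k) * (rho ^ S j * Cmod h ^ 2)) by (simpl; ring).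
  rewrite (Rmult_assoc ((INR k + 1) ^ 2)).
  apply Rmult_le_compat_r; [|nra].
  apply Rmult_le_pos; [easy|]. nra.
Qed.

Definition power_term (a : nat -> R) (z : C) (j : nat) : C :=
  (RtoC (a (S j)) * z ^ S j)%C.

Definition deriv_term (a : nat -> R) (z : C) (j : nat) : C :=
  (RtoC (INR (S j) * a (S j)) * z ^ j)%C.

Definition Csum (u : nat -> C) (m : nat) : C := @sum_n C_AbelianGroup u m.

Lemma Csum_0 (u : nat -> C) : Csum u 0 = u 0%nat.
Proof. apply (@sum_O C_AbelianGroup). Qed.

Lemma Csum_S (u : nat -> C) (m : nat) : Csum u (S m) = (Csum u m + u (S m))%C.
Proof. apply (@sum_Sn C_AbelianGroup). Qed.

(** The bound k^2 a_k <= 1 cancels the factor k^2 of each remainder, so a geometric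
    series dominates the sum. *)
Lemma Csum_taylor_le (a : nat -> R) (z h : C) (rho : R) (m : nat) :
  (forall k, (2 <= k)%nat -> 0 <= a k /\ INR k ^ 2 * a k <= 1) ->
  rho < 1 -> Cmod z <= rho -> Cmod (z + h)%C <= rho ->
  Cmod (Csum (power_term a (z + h)%C) m - Csum (power_term a z) m
        - h * Csum (deriv_term a z) m)%C
  <= Cmod h ^ 2 / (1 - rho).
Proof.
intros Ha Hrho Hz Hzh. assert (H0 := Cmod_ge_0 z). assert (Hh := Cmod_ge_0 h).
assert (Hh2 : 0 <= Cmod h ^ 2) by nra.
enough (H : Cmod (Csum (power_term a (z + h)%C) m - Csum (power_term a z) m
        - h * Csum (deriv_term a z) m)%C
  <= Cmod h ^ 2 * ((1 - rho ^ m) / (1 - rho))).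
{ eapply Rle_trans; [apply H|]. apply Rmult_le_compat_l; [easy|].
  assert (0 <= rho ^ m) by (apply pow_le; lra).
  rewrite <- (Rmult_1_l (/ (1 - rho))). apply Rmult_le_compat_r; [|lra].
  apply Rlt_le, Rinv_0_lt_compat; lra. }
induction m as [|m IH].
- rewrite !Csum_0. unfold power_term, deriv_term.
  match goal with |- Cmod ?x <= _ => replace x with (RtoC 0) end.
  + rewrite Cmod_0. simpl. apply Req_le. unfold Rdiv. ring.
  + simpl INR. rewrite Rmult_1_l. simpl. ring.
- rewrite !Csum_S. unfold power_term at 2 4, deriv_term at 2.
  destruct (Ha (S (S m))) as [Ha0 Ha1]; [lia|].
  set (k := S (S m)) in *.
  match goal with |- Cmod ?x <= _ => replace x with
    ((Csum (power_term a (z + h)) m - Csum (power_term a z) m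
      - h * Csum (deriv_term a z) m)
    + RtoC (a k) * ((z + h) ^ k - z ^ k - h * (RtoC (INR k) * z ^ S m)))%C end.
  2: { rewrite RtoC_mult. ring. }
  eapply Rle_trans; [apply Cmod_triangle|].
  rewrite Cmod_mult, Cmod_R, (Rabs_pos_eq (a k)) by easy.
  assert (H1 := Cmod_power_taylor_le z h rho m Hz Hzh).
  apply (Rmult_le_compat_l (a k)) in H1; [|easy]. fold k in H1.
  assert (Hr : 0 <= rho ^ m) by (apply pow_le; lra).
  assert (H2 : a k * (INR k ^ 2 * rho ^ m * Cmod h ^ 2) <= rho ^ m * Cmod h ^ 2).
  { replace (a k * (INR k ^ 2 * rho ^ m * Cmod h ^ 2))
      with ((INR k ^ 2 * a k) * (rho ^ m * Cmod h ^ 2)) by ring.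
    assert (0 <= rho ^ m * Cmod h ^ 2) by now apply Rmult_le_pos. nra. }
  replace (Cmod h ^ 2 * ((1 - rho ^ S m) / (1 - rho)))
    with (Cmod h ^ 2 * ((1 - rho ^ m) / (1 - rho)) + rho ^ m * Cmod h ^ 2)
    by (simpl; field; lra).
  lra.
Qed.

Lemma complex_polar (z : C) : exists w : R,
  z = (Cmod z * cos w, Cmod z * sin w).
Proof.
destruct (Req_dec (Cmod z) 0) as [E|N].
{ exists 0. rewrite E, !Rmult_0_l. now apply Cmod_eq_0. }
assert (Hp : 0 < Cmod z) by (assert (H := Cmod_ge_0 z); lra).
assert (E := Cmod2_alt z). destruct z as [x y]. cbn [Re Im fst snd] in E.
set (r := Cmod (x, y)) in *.
assert (Hx : -1 <= x / r <= 1).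
{ assert (E2 : (x / r) ^ 2 <= 1).
  { replace ((x / r) ^ 2) with (x ^ 2 / r ^ 2) by (field; lra).
    apply (Rmult_le_reg_r (r ^ 2)); [nra|]. unfold Rdiv.
    rewrite Rmult_assoc, Rinv_l by nra. nra. }
  nra. }
assert (Ec : r * cos (acos (x / r)) = x).
{ rewrite cos_acos by easy. field. lra. }
assert (Es : (r * sin (acos (x / r))) ^ 2 = y ^ 2).
{ assert (H := sin2_cos2 (acos (x / r))). unfold Rsqr in H. nra. }
assert (Hs : 0 <= sin (acos (x / r))).
{ apply sin_ge_0; apply acos_bound. }
destruct (Rle_lt_dec 0 y) as [Hy|Hy].
- exists (acos (x / r)). rewrite Ec. f_equal.
  assert (0 <= r * sin (acos (x / r))) by (apply Rmult_le_pos; lra). nra.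
- exists (- acos (x / r)). rewrite cos_neg, Ec, sin_neg. f_equal.
  assert (0 <= r * sin (acos (x / r))) by (apply Rmult_le_pos; lra). nra.
Qed.

Lemma Cpow_polar (r w : R) (j : nat) :
  Cpow (r * cos w, r * sin w) j
  = (r ^ j * cos (INR j * w), r ^ j * sin (INR j * w)).
Proof.
induction j as [|j IH].
- simpl. rewrite Rmult_0_l, cos_0, sin_0. unfold RtoC. f_equal; ring.
- rewrite S_INR, Rmult_plus_distr_r, Rmult_1_l, cos_plus, sin_plus.
  simpl Cpow. rewrite IH. unfold Cmult. cbn [fst snd pow]. f_equal; ring.
Qed.

Lemma Re_deriv_poly_polar (a : nat -> R) (r w : R) (m : nat) :
  let z := (r * cos w, r * sin w) in
  Re ((1 - z * z) * Csum (deriv_term a z) m)%C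
  = cos_poly_polar (fun k => INR k * a k) m r w.
Proof.
intros z. unfold cos_poly_polar.
assert (term : forall j, Re ((1 - z * z) * deriv_term a z j)%C
  = INR (S j) * a (S j) *
    (r ^ j * cos (INR j * w) - r ^ S (S j) * cos (INR (S (S j)) * w))).
{ intros j. unfold deriv_term. set (b := INR (S j) * a (S j)).
  replace ((1 - z * z) * (RtoC b * z ^ j))%C
    with (RtoC b * (z ^ j - z ^ S (S j)))%C by (simpl; ring).
  unfold z. rewrite !Cpow_polar. unfold Re, Cmult, Cminus, Cplus, Copp, RtoC.
  cbn [fst snd]. ring. }
induction m as [|m IH].
- rewrite Csum_0. apply term.
- rewrite Csum_S, tech5, <- IH, <- term.
  rewrite Cmult_plus_distr_l. reflexivity.
Qed.

Lemma Re_deriv_poly_ge (a e : nat -> R) (z : C) (m : nat) :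
  dominated_increments (fun k => INR k * a k) e -> Cmod z < 1 ->
  (1 - Cmod z) / (1 + Cmod z) <= Re ((1 - z * z) * Csum (deriv_term a z) m)%C.
Proof.
intros Hs Hz. destruct (complex_polar z) as [w E].
assert (H := Re_deriv_poly_polar a (Cmod z) w m). cbv zeta in H.
rewrite <- E in H. rewrite H.
apply (cos_poly_polar_ge _ e); [easy|]. split; [apply Cmod_ge_0|easy].
Qed.

(** * The coefficient condition *)

Lemma dominated_increments_INR_mul_le (b e : nat -> R) (k : nat) :
  dominated_increments b e -> (2 <= k)%nat -> INR k * b k <= 1.
Proof.
intros (_ & _ & H2 & He) Hk.
enough (INR k * b k <= e k) by (destruct (He k Hk); lra).
induction Hk as [|k Hk IH].
- simpl INR. lra.
- destruct (He k Hk) as (_ & _ & H). lra.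
Qed.

(** Write k b_k = e_k c_k with e_k = k / W_k nondecreasing and c_k = W_k b_k
    nonincreasing and at most 1; then
    k b_k can only increase by c_(k+1) (e_(k+1) - e_k) at most. *)
Lemma dominated_increments_of_weight (W b : nat -> R) :
  b 1%nat = 1 ->
  (forall k, (2 <= k)%nat -> 0 <= b k) ->
  (forall k, (2 <= k)%nat ->
     INR k <= W k /\ W k <= W (S k) /\ INR k * W (S k) <= INR (S k) * W k) ->
  W 2%nat * b 2%nat <= 1 ->
  (forall k, (2 <= k)%nat -> W (S k) * b (S k) <= W k * b k) ->
  dominated_increments b (fun k => INR k / W k).
Proof.
intros Hb1 Hb HW H2 Hdec.
assert (Hk0 : forall k, (2 <= k)%nat -> 0 < INR k) by (intros k Hk; apply lt_0_INR; lia).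
assert (HW0 : forall k, (2 <= k)%nat -> 0 < W k).
{ intros k Hk. destruct (HW k Hk). specialize (Hk0 k Hk). lra. }
assert (Hc : forall k, (2 <= k)%nat -> W k * b k <= 1).
{ intros k Hk. induction Hk as [|k Hk IH]; [easy|]. specialize (Hdec k Hk). lra. }
assert (HD : forall k, (2 <= k)%nat -> INR k * b k = INR k / W k * (W k * b k)).
{ intros k Hk. field. apply Rgt_not_eq, HW0, Hk. }
assert (He0 : forall k, (2 <= k)%nat -> 0 < INR k / W k).
{ intros k Hk. apply Rdiv_lt_0_compat; auto. }
assert (He : forall k, (2 <= k)%nat -> INR k / W k <= INR (S k) / W (S k)).
{ intros k Hk. destruct (HW k Hk) as (_ & _ & H).
  assert (Hw := HW0 k Hk). assert (Hw' := HW0 (S k) ltac:(lia)).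
  apply (Rmult_le_reg_r (W k * W (S k))); [now apply Rmult_lt_0_compat|].
  replace (INR k / W k * (W k * W (S k))) with (INR k * W (S k)) by (field; lra).
  replace (INR (S k) / W (S k) * (W k * W (S k))) with (INR (S k) * W k)
    by (field; lra). easy. }
split; [easy|]. split; [|split].
- intros k Hk. split; [now apply Hb|].
  destruct (HW k Hk) as (_ & H & _). specialize (Hdec k Hk).
  assert (Hw := HW0 k Hk). specialize (Hb (S k) ltac:(lia)).
  apply (Rmult_le_reg_l (W k)); [easy|].
  eapply Rle_trans; [|apply Hdec]. now apply Rmult_le_compat_r.
- replace (2 * b 2%nat) with (INR 2 * b 2%nat) by (simpl; ring).
  rewrite HD by lia. specialize (He0 2%nat (le_n _)). nra.
- intros k Hk. split; [|split].
  + destruct (HW k Hk) as (H & _). assert (Hw := HW0 k Hk).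
    apply (Rmult_le_reg_r (W k)); [easy|]. unfold Rdiv.
    rewrite Rmult_assoc, Rinv_l by lra. lra.
  + now apply He.
  + rewrite (HD k Hk), (HD (S k)) by lia.
    specialize (He k Hk). specialize (He0 k Hk).
    specialize (Hdec k Hk). specialize (Hc (S k) ltac:(lia)).
    assert (INR k / W k * (W (S k) * b (S k)) <= INR k / W k * (W k * b k))
      by (apply Rmult_le_compat_l; lra).
    nra.
Qed.

Definition mean_weight (alpha beta l m x : R) : R :=
  Rpower (x + alpha) l * Rpower (x + beta) m.

(** A weighted geometric mean of x + alpha and x + beta grows at most in proportion
    to x, because each of the two factors does. *)
Lemma mean_weight_props (alpha beta l m x : R) :
  0 <= alpha -> 0 <= beta -> 0 <= l -> 0 <= m -> l + m = 1 -> 0 < x ->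
  x <= mean_weight alpha beta l m x /\
  mean_weight alpha beta l m x <= mean_weight alpha beta l m (x + 1) /\
  x * mean_weight alpha beta l m (x + 1) <= (x + 1) * mean_weight alpha beta l m x.
Proof.
intros Ha Hb Hl Hm Hlm Hx. unfold mean_weight.
assert (mono : forall u v u' v', 0 < u <= u' -> 0 < v <= v' ->
  Rpower u l * Rpower v m <= Rpower u' l * Rpower v' m).
{ intros u v u' v' Hu Hv.
  apply Rmult_le_compat; try (apply Rlt_le, exp_pos); now apply Rle_Rpower_l. }
assert (pw : forall u, 0 < u -> Rpower u l * Rpower u m = u).
{ intros u Hu. rewrite <- Rpower_plus, Hlm. now apply Rpower_1. }
split; [|split].
- rewrite <- (pw x Hx) at 1. apply mono; lra.
- apply mono; lra.
- set (q := (x + 1) / x).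
  assert (Hq : 0 < q) by (apply Rdiv_lt_0_compat; lra).
  assert (Hq1 : q * x = x + 1) by (unfold q; field; lra).
  assert (Hq2 : 1 <= q).
  { apply (Rmult_le_reg_r x); lra. }
  rewrite <- Hq1. replace (q * x * (Rpower (x + alpha) l * Rpower (x + beta) m))
    with (x * (q * (Rpower (x + alpha) l * Rpower (x + beta) m))) by ring.
  apply Rmult_le_compat_l; [lra|].
  rewrite <- (pw q Hq) at 3.
  replace (Rpower q l * Rpower q m * (Rpower (x + alpha) l * Rpower (x + beta) m))
    with ((Rpower q l * Rpower (x + alpha) l) * (Rpower q m * Rpower (x + beta) m)) by ring.
  rewrite !Rpower_mult_distr by lra.
  apply mono; nra.
Qed.

(** Dividing the exponents by s = lambda + mu >= 1 reduces to exponents of sum 1: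
    the given weight is W^s = W W^(s-1) with W nondecreasing and W_2 >= 1, so the
    hypotheses remain true with the factor W^(s-1) removed. *)
Lemma coefficients_dominated_increments (alpha beta lambda mu : R) (a : nat -> R) :
  0 <= alpha -> 0 <= beta -> 0 <= lambda -> 0 <= mu ->
  1 <= lambda + mu ->
  (forall k : nat, (1 <= k)%nat -> 0 < a k) ->
  a 1%nat = 1 ->
  Rpower (2 + alpha) lambda * Rpower (2 + beta) mu * (2 * a 2%nat) <= 1 ->
  (forall k : nat, (2 <= k)%nat ->
     Rpower (INR k + 1 + alpha) lambda * Rpower (INR k + 1 + beta) mu
       * ((INR k + 1) * a (k + 1)%nat)
     <= Rpower (INR k + alpha) lambda * Rpower (INR k + beta) mu
       * (INR k * a k)) ->
  exists e, dominated_increments (fun k => INR k * a k) e.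
Proof.
intros Ha Hb Hl Hm Hs Hpos Ha1 H2 Hdec.
set (s := lambda + mu) in *.
set (W := mean_weight alpha beta (lambda / s) (mu / s)).
assert (HW : forall x, 0 < x -> x <= W x /\ W x <= W (x + 1)
   /\ x * W (x + 1) <= (x + 1) * W x).
{ intros x Hx. apply mean_weight_props; try easy.
  - apply Rmult_le_pos; [|apply Rlt_le, Rinv_0_lt_compat]; lra.
  - apply Rmult_le_pos; [|apply Rlt_le, Rinv_0_lt_compat]; lra.
  - unfold s. field. unfold s in Hs. lra. }
assert (HV : forall x, 0 < x ->
  Rpower (x + alpha) lambda * Rpower (x + beta) mu = W x * Rpower (W x) (s - 1)).
{ intros x Hx. destruct (HW x Hx) as [H _].
  rewrite <- (Rpower_1 (W x)) at 1 by lra. rewrite <- Rpower_plus.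
  replace (1 + (s - 1)) with s by ring.
  unfold W, mean_weight.
  rewrite <- Rpower_mult_distr by apply exp_pos. rewrite !Rpower_mult.
  f_equal; f_equal; field; lra. }
exists (fun k => INR k / W (INR k)).
assert (HS : forall k, (2 <= k)%nat -> 2 <= INR k).
{ intros k Hk. replace 2 with (INR 2) by (simpl; ring). now apply le_INR. }
apply (dominated_increments_of_weight (fun k => W (INR k))).
- simpl INR. rewrite Ha1. ring.
- intros k Hk. apply Rmult_le_pos; [apply pos_INR|]. apply Rlt_le, Hpos. lia.
- intros k Hk. rewrite S_INR. apply HW. specialize (HS k Hk). lra.
- rewrite HV in H2 by lra. simpl INR.
  replace (1 + 1) with 2 by ring.
  destruct (HW 2) as [H _]; [lra|].
  assert (H1 : 1 <= Rpower (W 2) (s - 1)).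
  { rewrite <- (Rpower_O (W 2)) at 1 by lra. apply Rle_Rpower; lra. }
  assert (Hp := Hpos 2%nat ltac:(lia)).
  assert (H3 : 0 <= W 2 * (2 * a 2%nat)) by (apply Rmult_le_pos; lra).
  nra.
- intros k Hk. specialize (Hdec k Hk). specialize (HS k Hk).
  rewrite !HV in Hdec by lra. rewrite Nat.add_1_r in Hdec. rewrite S_INR.
  destruct (HW (INR k)) as (H & H' & _); [lra|].
  set (P := Rpower (W (INR k)) (s - 1)) in *.
  set (P' := Rpower (W (INR k + 1)) (s - 1)) in *.
  assert (HP : P <= P') by (apply Rle_Rpower_l; lra).
  assert (HP' : 0 < P') by apply exp_pos.
  assert (Hp := Hpos k ltac:(lia)).
  assert (Hd : 0 <= W (INR k) * (INR k * a k)).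
  { apply Rmult_le_pos; [lra|]. apply Rmult_le_pos; lra. }
  apply (Rmult_le_reg_l P'); [easy|].
  assert (P * (W (INR k) * (INR k * a k)) <= P' * (W (INR k) * (INR k * a k)))
    by (now apply Rmult_le_compat_r).
  lra.
Qed.

(** * The comparison function z / (1 - z^2) *)

(** The image of the disk is the plane slit along the imaginary axis from i/2 and
    -i/2 to infinity. *)
Definition two_slit_map (z : C) : C := (z / (1 - z * z))%C.

Lemma Cmod_one_minus_ge (w : C) : 1 - Cmod w <= Cmod (1 - w)%C.
Proof.
assert (H := Cmod_triangle (1 - w) w).
replace (1 - w + w)%C with (RtoC 1) in H by ring. rewrite Cmod_1 in H. lra.
Qed.

Lemma Cmod_one_minus_sqr_ge (z : C) (rho : R) :
  Cmod z <= rho -> rho < 1 -> 1 - rho <= Cmod (1 - z * z)%C.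
Proof.
intros Hz Hr. assert (H := Cmod_one_minus_ge (z * z)). rewrite Cmod_mult in H.
assert (H0 := Cmod_ge_0 z). nra.
Qed.

Lemma one_minus_sqr_neq_0 (z : C) : Cmod z < 1 -> (1 - z * z)%C <> 0%C.
Proof.
intros Hz. apply Cmod_gt_0.
assert (H := Cmod_one_minus_sqr_ge z (Cmod z) (Rle_refl _) Hz). lra.
Qed.

Lemma disk_radius_add (z h : C) (rho : R) :
  rho = (1 + Cmod z) / 2 -> Cmod h < 1 - rho -> Cmod (z + h)%C <= rho.
Proof. intros E Hh. assert (H := Cmod_triangle z h). lra. Qed.

(** The remainder of order two is
    h^2 ((1 + z^2)(2z + h) + z (1 - z^2)) / ((1 - z^2)^2 (1 - (z+h)^2)). *)
Lemma two_slit_map_derive (z : C) : Cmod z < 1 ->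
  @is_derive C_AbsRing C_NormedModule two_slit_map z
    ((1 + z * z) / ((1 - z * z) * (1 - z * z)))%C.
Proof.
intros Hz. set (rho := (1 + Cmod z) / 2).
assert (Hr : Cmod z < rho < 1) by (unfold rho; lra).
assert (H0 := Cmod_ge_0 z).
apply (is_C_derive_of_quadratic _ _ _ (1 - rho) (8 / (1 - rho) ^ 3)).
- lra.
- apply Rmult_le_pos; [lra|]. apply Rlt_le, Rinv_0_lt_compat, pow_lt. lra.
- intros h Hh. assert (Hzh := disk_radius_add z h rho eq_refl Hh).
  assert (Hh0 := Cmod_ge_0 h).
  assert (HA := one_minus_sqr_neq_0 z Hz).
  assert (HB := one_minus_sqr_neq_0 (z + h)%C ltac:(lra)).
  assert (HA' := Cmod_one_minus_sqr_ge z rho ltac:(lra) ltac:(lra)).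
  assert (HB' := Cmod_one_minus_sqr_ge (z + h)%C rho Hzh ltac:(lra)).
  unfold two_slit_map.
  replace ((z + h) / (1 - (z + h) * (z + h)) - z / (1 - z * z)
     - h * ((1 + z * z) / ((1 - z * z) * (1 - z * z))))%C
    with (h * h * ((1 + z * z) * (z + z + h) + z * (1 - z * z))
       / ((1 - z * z) * (1 - z * z) * (1 - (z + h) * (z + h))))%C
    by (field; split; assumption).
  rewrite Cmod_div by (repeat apply Cmult_neq_0; assumption).
  rewrite !Cmod_mult.
  assert (HQ : Cmod ((1 + z * z) * (z + z + h) + z * (1 - z * z))%C <= 8).
  { assert (H1 : Cmod (1 + z * z)%C <= 2).
    { eapply Rle_trans; [apply Cmod_triangle|]. rewrite Cmod_1, Cmod_mult. nra. }
    assert (H2 : Cmod (z + z + h)%C <= 3).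
    { eapply Rle_trans; [apply Cmod_triangle|].
      assert (H := Cmod_triangle z z). lra. }
    assert (H3 : Cmod (1 - z * z)%C <= 2).
    { eapply Rle_trans; [apply Cmod_triangle|].
      rewrite Cmod_1, Cmod_opp, Cmod_mult. nra. }
    eapply Rle_trans; [apply Cmod_triangle|]. rewrite !Cmod_mult.
    assert (H4 := Cmod_ge_0 (1 + z * z)%C). assert (H5 := Cmod_ge_0 (z + z + h)%C).
    assert (H6 := Cmod_ge_0 (1 - z * z)%C). nra. }
  assert (Hp : 0 < (1 - rho) ^ 3) by (apply pow_lt; lra).
  assert (Hden : (1 - rho) ^ 3 <= Cmod (1 - z * z)%C * Cmod (1 - z * z)%C
                   * Cmod (1 - (z + h) * (z + h))%C).
  { replace ((1 - rho) ^ 3) with ((1 - rho) * (1 - rho) * (1 - rho)) by ring.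
    repeat apply Rmult_le_compat; try lra. apply Rmult_le_pos; lra. }
  replace (8 / (1 - rho) ^ 3 * Cmod h ^ 2)
    with (Cmod h * Cmod h * 8 * / (1 - rho) ^ 3) by (unfold Rdiv; ring).
  apply Rmult_le_compat.
  + repeat apply Rmult_le_pos; try apply Cmod_ge_0.
  + apply Rlt_le, Rinv_0_lt_compat. lra.
  + apply Rmult_le_compat_l; [now apply Rmult_le_pos|easy].
  + apply Rinv_le_contravar; lra.
Qed.

Lemma Re_cayley_pos (w : C) : Cmod w < 1 -> 0 < Re ((1 + w) / (1 - w))%C.
Proof.
intros Hw. assert (E := Cmod2_alt w). assert (H0 := Cmod_ge_0 w).
destruct w as [x y]. cbn [Re Im fst snd] in E.
assert (Hxy : x ^ 2 + y ^ 2 < 1) by nra.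
assert (Hd : 0 < (1 - x) ^ 2 + y ^ 2) by nra.
replace (Re ((1 + (x, y)) / (1 - (x, y)))%C)
  with ((1 - (x ^ 2 + y ^ 2)) / ((1 - x) ^ 2 + y ^ 2)).
- apply Rdiv_lt_0_compat; lra.
- unfold Re, Cdiv, Cinv, Cmult, Cminus, Cplus, Copp, RtoC. cbn [fst snd].
  field. intros H. nra.
Qed.

Lemma two_slit_map_class_A0 : class_A0 two_slit_map.
Proof.
split; [|split].
- intros z Hz. eexists. now apply two_slit_map_derive.
- unfold two_slit_map. field. 
- rewrite (is_C_derive_unique _ _ _ (two_slit_map_derive 0%C ltac:(rewrite Cmod_0; lra))).
  field.
Qed.

Lemma zf'_over_two_slit_map (f : C -> C) (z d : C) :
  Cmod z < 1 -> z <> 0%C -> @is_derive C_AbsRing C_NormedModule f z d ->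
  zf'_over_g f two_slit_map z = ((1 - z * z) * d)%C.
Proof.
intros Hz Hz0 Hd. unfold zf'_over_g. destruct (Ceq_dec z 0%C) as [E|_]; [easy|].
rewrite (is_C_derive_unique _ _ _ Hd). unfold two_slit_map.
assert (H := one_minus_sqr_neq_0 z Hz). field. split; assumption.
Qed.

Lemma two_slit_map_starlike : starlike two_slit_map.
Proof.
split; [apply two_slit_map_class_A0|].
intros z Hz. destruct (Ceq_dec z 0%C) as [->|Hz0].
{ unfold zf'_over_g. destruct (Ceq_dec 0%C 0%C); [|easy]. simpl. lra. }
rewrite (zf'_over_two_slit_map _ _ _ Hz Hz0 (two_slit_map_derive z Hz)).
assert (H := one_minus_sqr_neq_0 z Hz).
replace ((1 - z * z) * ((1 + z * z) / ((1 - z * z) * (1 - z * z))))%C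
  with ((1 + z * z) / (1 - z * z))%C by (field; exact H).
apply Re_cayley_pos. rewrite Cmod_mult.
assert (H0 := Cmod_ge_0 z). unfold unit_disk in Hz. nra.
Qed.

(** The angle eta = 0 serves: z f'(z) / g(z) is (1 - z^2) f'(z) for
    g(z) = z / (1 - z^2). *)
Lemma close_to_convex_two_slit (f d : C -> C) :
  f 0%C = 0%C -> d 0%C = 1%C ->
  (forall z, Cmod z < 1 -> @is_derive C_AbsRing C_NormedModule f z (d z)) ->
  (forall z, Cmod z < 1 -> 0 < Re ((1 - z * z) * d z)%C) ->
  close_to_convex f two_slit_map.
Proof.
intros Hf0 Hd0 Hd Hpos. split; [|split; [apply two_slit_map_starlike|]].
- split; [|split; [easy|]].
  + intros z Hz. exists (d z). now apply Hd.
  + rewrite (is_C_derive_unique _ _ _ (Hd 0%C ltac:(rewrite Cmod_0; lra))). easy.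
- exists 0. split; [assert (H := PI_RGT_0); lra|].
  intros z Hz.
  replace (cis 0) with (RtoC 1) by (unfold cis; now rewrite cos_0, sin_0).
  rewrite Cmult_1_l.
  destruct (Ceq_dec z 0%C) as [->|Hz0].
  { unfold zf'_over_g. destruct (Ceq_dec 0%C 0%C); [|easy]. simpl. lra. }
  rewrite (zf'_over_two_slit_map f z (d z)); auto.
Qed.

(** * Partial sums and the power series *)

Lemma partial_poly_Csum (a : nat -> R) (m : nat) (z : C) :
  a 1%nat = 1 -> partial_poly a (S m) z = Csum (power_term a z) m.
Proof.
intros Ha. unfold partial_poly. induction m as [|m IH].
- rewrite Csum_0, sum_n_m_zero by lia. unfold power_term. rewrite Ha.
  change (z + 0 = 1 * z ^ 1)%C. simpl. ring.
- rewrite Csum_S, <- IH, (sum_n_Sm _ 2 (S m)) by lia.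
  change (@plus ?G) with Cplus. unfold power_term. ring.
Qed.

Lemma Csum_deriv_at_0 (a : nat -> R) (m : nat) :
  a 1%nat = 1 -> Csum (deriv_term a 0%C) m = 1%C.
Proof.
intros Ha. induction m as [|m IH].
- rewrite Csum_0. unfold deriv_term. rewrite Ha. simpl. rewrite Rmult_1_r. ring.
- rewrite Csum_S, IH. unfold deriv_term. simpl. ring.
Qed.

Lemma Csum_power_at_0 (a : nat -> R) (m : nat) : Csum (power_term a 0%C) m = 0%C.
Proof.
induction m as [|m IH].
- rewrite Csum_0. unfold power_term. simpl. ring.
- rewrite Csum_S, IH. unfold power_term. simpl. ring.
Qed.

Lemma is_C_derive_power_poly (a : nat -> R) (m : nat) (z : C) :
  (forall k, (2 <= k)%nat -> 0 <= a k /\ INR k ^ 2 * a k <= 1) -> Cmod z < 1 ->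
  @is_derive C_AbsRing C_NormedModule (fun z => Csum (power_term a z) m) z
    (Csum (deriv_term a z) m).
Proof.
intros Ha Hz. set (rho := (1 + Cmod z) / 2).
assert (Hr : Cmod z < rho < 1) by (unfold rho; lra).
apply (is_C_derive_of_quadratic _ _ _ (1 - rho) (/ (1 - rho))); [lra| |].
- apply Rlt_le, Rinv_0_lt_compat. lra.
- intros h Hh. rewrite Rmult_comm.
  apply Csum_taylor_le; try easy; [lra|].
  now apply (disk_radius_add z h rho).
Qed.

Lemma Ccvg_const (u : nat -> C) (l c : C) :
  Ccvg u l -> (forall m, u m = c) -> l = c.
Proof.
intros H E.
assert (H0 : Cmod (c - l)%C = 0).
{ apply Rle_antisym; [|apply Cmod_ge_0]. apply le_epsilon. intros eps Heps.
  destruct (H eps Heps) as [N HN]. specialize (HN N (le_n _)). rewrite E in HN. lra. }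
apply Cmod_eq_0 in H0.
replace l with (c - (c - l))%C by ring. rewrite H0. ring.
Qed.

Lemma Re_ge_Ccvg (u : nat -> C) (l c : C) (kappa : R) :
  Ccvg u l -> (forall m, kappa <= Re (c * u m)%C) -> kappa <= Re (c * l)%C.
Proof.
intros H Hk. apply le_epsilon. intros eps Heps.
assert (Hc := Cmod_ge_0 c).
assert (He : 0 < eps / (Cmod c + 1)) by (apply Rdiv_lt_0_compat; lra).
destruct (H _ He) as [N HN]. specialize (HN N (le_n _)). specialize (Hk N).
assert (H1 : Rabs (Re (c * (u N - l))%C) <= eps).
{ eapply Rle_trans; [apply re_le_Cmod|]. rewrite Cmod_mult.
  assert (H2 : (Cmod c + 1) * (eps / (Cmod c + 1)) = eps) by (field; lra).
  assert (H3 := Cmod_ge_0 (u N - l)%C). nra. }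
apply Rabs_le_between in H1.
replace (Re (c * (u N - l))%C) with (Re (c * u N)%C - Re (c * l)%C) in H1.
- lra.
- destruct c, (u N), l. unfold Re, Cmult, Cminus, Cplus, Copp. cbn [fst snd]. ring.
Qed.

Lemma is_C_derive_power_series (a : nat -> R) (f d : C -> C) (z : C) :
  (forall k, (2 <= k)%nat -> 0 <= a k /\ INR k ^ 2 * a k <= 1) ->
  (forall z, Cmod z < 1 -> Ccvg (Csum (power_term a z)) (f z)) ->
  (forall z, Cmod z < 1 -> Ccvg (Csum (deriv_term a z)) (d z)) ->
  Cmod z < 1 -> @is_derive C_AbsRing C_NormedModule f z (d z).
Proof.
intros Ha Hf Hd Hz. set (rho := (1 + Cmod z) / 2).
assert (H0 := Cmod_ge_0 z).
assert (Hr : Cmod z < rho < 1) by (unfold rho; lra).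
apply (is_C_derive_of_quadratic _ _ _ (1 - rho) (/ (1 - rho))); [lra| |].
- apply Rlt_le, Rinv_0_lt_compat. lra.
- intros h Hh. rewrite Rmult_comm.
  assert (Hzh := disk_radius_add z h rho eq_refl Hh).
  apply le_epsilon. intros eps Heps. assert (He : 0 < eps / 3) by lra.
  destruct (Hf z Hz _ He) as [N1 HN1].
  destruct (Hf (z + h)%C ltac:(lra) _ He) as [N2 HN2].
  destruct (Hd z Hz _ He) as [N3 HN3].
  set (N := (N1 + N2 + N3)%nat).
  specialize (HN1 N ltac:(unfold N; lia)). specialize (HN2 N ltac:(unfold N; lia)).
  specialize (HN3 N ltac:(unfold N; lia)).
  assert (HT := Csum_taylor_le a z h rho N Ha (proj2 Hr) ltac:(lra) Hzh).
  set (S1 := Csum (power_term a z) N) in *.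
  set (S2 := Csum (power_term a (z + h)%C) N) in *.
  set (S3 := Csum (deriv_term a z) N) in *.
  replace (f (z + h) - f z - h * d z)%C
    with ((S2 - S1 - h * S3) + (- (S2 - f (z + h)) + ((S1 - f z) + h * (S3 - d z))))%C by ring.
  eapply Rle_trans; [apply Cmod_triangle|]. apply Rplus_le_compat; [exact HT|].
  eapply Rle_trans; [apply Cmod_triangle|]. rewrite Cmod_opp.
  assert (H1 := Cmod_triangle (S1 - f z) (h * (S3 - d z))). rewrite Cmod_mult in H1.
  assert (H2 := Cmod_ge_0 h). assert (H3 := Cmod_ge_0 (S3 - d z)%C). nra.
Qed.

Lemma ex_series_of_geometric_bound (u : nat -> C) (q : R) :
  0 <= q < 1 -> (forall j, Cmod (u j) <= q ^ j) ->
  exists l, @is_series C_AbsRing C_NormedModule u l.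
Proof.
intros Hq Hu.
apply (@ex_series_le C_AbsRing C_CompleteNormedModule u (fun j => q ^ j)).
- exact Hu.
- apply ex_series_geom. rewrite Rabs_pos_eq; lra.
Qed.

(** Uniqueness of the limit makes the operator iota of a complete space select
    it. *)
Definition series_sum (u : nat -> C) : C :=
  @iota C_CompleteNormedModule
    (fun l => @is_series C_AbsRing C_NormedModule u l).

Lemma series_sum_correct (u : nat -> C) :
  (exists l, @is_series C_AbsRing C_NormedModule u l) ->
  @is_series C_AbsRing C_NormedModule u (series_sum u).
Proof.
intros [l Hl].
apply (@iota_correct C_AbsRing C_CompleteNormedModule
  (fun l => @is_series C_AbsRing C_NormedModule u l)).
exists l. split; [exact Hl|]. intros l' Hl'.
apply (@filterlim_locally_unique _ C_AbsRing C_NormedModule eventually _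
  (@sum_n C_AbelianGroup u)); assumption.
Qed.

Lemma is_series_tail_of_power_terms (a : nat -> R) (z l : C) :
  a 1%nat = 1 ->
  @is_series C_AbsRing C_NormedModule (power_term a z) l ->
  @is_series C_AbsRing C_NormedModule
    (fun k : nat => RtoC (a (k + 2)%nat) * Cpow z (k + 2))%C (l - z)%C.
Proof.
intros Ha H.
apply (@is_series_ext C_AbsRing C_NormedModule (fun k => power_term a z (S k))).
- intros k. unfold power_term. replace (k + 2)%nat with (S (S k)) by lia. reflexivity.
- apply (@is_series_incr_1 C_AbsRing C_NormedModule (power_term a z)).
  replace (@plus C_NormedModule (l - z)%C (power_term a z 0)) with l; [exact H|].
  change (l = (l - z) + power_term a z 0)%C. unfold power_term. rewrite Ha.
  simpl. ring.
Qed.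

Theorem theorem2p2 :
  forall (alpha beta lambda mu : R) (a : nat -> R),
  0 <= alpha -> 0 <= beta -> 0 <= lambda -> 0 <= mu ->
  1 <= lambda + mu ->
  (forall k : nat, (1 <= k)%nat -> 0 < a k) ->
  a 1%nat = 1 ->
  Rpower (2 + alpha) lambda * Rpower (2 + beta) mu * (2 * a 2%nat) <= 1 ->
  (forall k : nat, (2 <= k)%nat ->
     Rpower (INR k + 1 + alpha) lambda * Rpower (INR k + 1 + beta) mu
       * ((INR k + 1) * a (k + 1)%nat)
     <= Rpower (INR k + alpha) lambda * Rpower (INR k + beta) mu
       * (INR k * a k)) ->
  (forall n : nat, (1 <= n)%nat ->
     close_to_convex (partial_poly a n) (fun z : C => z / (1 - z * z))%C) /\
  (exists f : C -> C,
     is_power_series_sum a f /\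
     close_to_convex f (fun z : C => z / (1 - z * z))%C).
Proof.
intros alpha beta lambda mu a Ha Hb Hl Hm Hs Hpos Ha1 H2 Hdec.
destruct (coefficients_dominated_increments alpha beta lambda mu a) as [e He]; try assumption.
assert (Hk : forall k, (2 <= k)%nat -> 0 <= a k /\ INR k ^ 2 * a k <= 1).
{ intros k Hk. split; [apply Rlt_le, Hpos; lia|].
  replace (INR k ^ 2 * a k) with (INR k * (INR k * a k)) by ring.
  exact (dominated_increments_INR_mul_le _ _ k He Hk). }
assert (Hharnack : forall z, Cmod z < 1 -> 0 < (1 - Cmod z) / (1 + Cmod z)).
{ intros z Hz. assert (H := Cmod_ge_0 z). apply Rdiv_lt_0_compat; lra. }
split.
- intros [|m] Hn; [lia|].
  apply (close_to_convex_two_slit _ (fun z => Csum (deriv_term a z) m)).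
  + rewrite partial_poly_Csum by easy. apply Csum_power_at_0.
  + now apply Csum_deriv_at_0.
  + intros z Hz.
    apply (@is_derive_ext C_AbsRing C_NormedModule
             (fun z => Csum (power_term a z) m)).
    * intros t. symmetry. now apply partial_poly_Csum.
    * now apply is_C_derive_power_poly.
  + intros z Hz. eapply Rlt_le_trans; [now apply (Hharnack z)|].
    now apply (Re_deriv_poly_ge a e).
- assert (Hbnd : forall j, 0 <= a (S j) <= 1 /\ 0 <= INR (S j) * a (S j) <= 1).
  { intros j. assert (H0 := Hpos (S j) ltac:(lia)).
    destruct j as [|j]; [simpl INR; rewrite Ha1; lra|].
    destruct (Hk (S (S j)) ltac:(lia)) as [_ H].
    assert (H1 : 1 <= INR (S (S j))).
    { replace 1 with (INR 1) by reflexivity. apply le_INR. lia. }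
    assert (INR (S (S j)) * a (S (S j)) <= 1).
    { set (k := INR (S (S j))) in *. nra. }
    set (k := INR (S (S j))) in *. split; split; nra. }
  assert (Hf : forall z, Cmod z < 1 ->
    @is_series C_AbsRing C_NormedModule (power_term a z) (series_sum (power_term a z))).
  { intros z Hz. apply series_sum_correct.
    assert (H0 := Cmod_ge_0 z).
    apply (ex_series_of_geometric_bound _ (Cmod z)); [lra|].
    intros j. unfold power_term. rewrite Cmod_mult, Cmod_R, Cmod_pow.
    destruct (Hbnd j) as [H1 _]. rewrite Rabs_pos_eq by lra.
    assert (H3 : 0 <= Cmod z ^ j) by now apply pow_le. cbn [pow].
    assert (H4 : 0 <= Cmod z * Cmod z ^ j <= Cmod z ^ j) by nra. nra. }
  assert (Hd : forall z, Cmod z < 1 ->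
    @is_series C_AbsRing C_NormedModule (deriv_term a z) (series_sum (deriv_term a z))).
  { intros z Hz. apply series_sum_correct.
    assert (H0 := Cmod_ge_0 z).
    apply (ex_series_of_geometric_bound _ (Cmod z)); [lra|].
    intros j. unfold deriv_term. rewrite Cmod_mult, Cmod_R, Cmod_pow.
    destruct (Hbnd j) as [_ H1]. rewrite Rabs_pos_eq by lra.
    assert (H3 : 0 <= Cmod z ^ j) by now apply pow_le. nra. }
  assert (H0 : Cmod 0%C < 1) by (rewrite Cmod_0; lra).
  exists (fun z => series_sum (power_term a z)). split.
  + intros z Hz. exists (series_sum (power_term a z) - z)%C. split; [|ring].
    apply is_series_tail_of_power_terms; [easy|]. now apply Hf.
  + apply (close_to_convex_two_slit _ (fun z => series_sum (deriv_term a z))).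
    * apply (Ccvg_const _ _ _ (Ccvg_series _ _ (Hf 0%C H0))).
      intros m. apply Csum_power_at_0.
    * apply (Ccvg_const _ _ _ (Ccvg_series _ _ (Hd 0%C H0))).
      intros m. now apply Csum_deriv_at_0.
    * intros z Hz. apply (is_C_derive_power_series a _ (fun z => series_sum (deriv_term a z)));
        try easy.
      -- intros w Hw. apply Ccvg_series. now apply Hf.
      -- intros w Hw. apply Ccvg_series. now apply Hd.
    * intros z Hz. eapply Rlt_le_trans; [now apply (Hharnack z)|].
      apply (Re_ge_Ccvg _ _ _ _ (Ccvg_series _ _ (Hd z Hz))).
      intros m. now apply (Re_deriv_poly_ge a e).
Qed.
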